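(* Let $A$ and $B$ be two $k\times k$ matrices and let $T$ be the integral operator on vector-valued functions $\vec{p}:[0,1]\to\mathbb{C}^k$ (in $L^2([0,1];\mathbb{C}^k)$) defined by $$T(\vec{p})(x)=A\cdot\int_0^x \vec{p}(t)\,dt+B\cdot\int_x^1\vec{p}(t)\,dt ,$$ where the integration is componentwise. For $\lambda\in\mathbb{C}\setminus\{0\}$ put $$P=P(\lambda)=-\lambda\cdot I+B\cdot\gamma\big((A-B)/\lambda\big).$$ Then the non-zero spectrum of $T$ is the set of non-zero roots $\lambda$ of the equation $\det(P)=0$, and the eigenfunctions associated with such a $\lambda$ are of the form $$\vec{p}(x)=e^{(A-B)/\lambda\,\cdot\, x}\cdot\vec{c},$$ where the (non-zero) vector $\vec{c}$ satisfies the equation $P\cdot\vec{c}=0$.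
   Context: For a square matrix $M$, $e^M=\sum_{j\ge0}M^j/j!$ and $\gamma(M)=\int_0^1 e^{M t}\,dt$ (entrywise integration); equivalently $\gamma(M)=\sum_{j\ge 0}M^j/(j+1)!$. The spectrum of an operator $T$ is the set of $\lambda\in\mathbb{C}$ such that $T-\lambda I$ is not invertible. $I$ denotes the identity matrix or operator. Matrices may have complex entries. *)

(* Defs.v *)
From HB Require Import structures.
From mathcomp Require Import all_boot all_order all_algebra.
From mathcomp Require Import ring_quotient.
From mathcomp Require Import all_classical all_reals all_analysis.
From mathcomp Require Import measurable_realfun.
From mathcomp Require Import complex.

Set Implicit Arguments.
Unset Strict Implicit.
Unset Printing Implicit Defensive.

Import Order.TTheory GRing.Theory Num.Theory.
Import numFieldNormedType.Exports.

Local Open Scope classical_set_scope.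
Local Open Scope ring_scope.
Local Open Scope complex_scope.
Local Open Scope quotient_scope.

(* The topology and the norm of the numeric field R[i], so that limits of
   complex matrices make sense. *)
HB.instance Definition _ (R : rcfType) :=
  NormedModule.copy R[i] (R[i] : numClosedFieldType)^o.

Definition expmx (R : realType) (k : nat) (M : 'M[R[i]]_k) : 'M[R[i]]_k :=
  limn [series (j`!%:R)^-1 *: M ^+ j]_j.

(* The library integral is for (extended) real-valued functions; a
   complex-valued function is integrated through its real and imaginary parts. *)
Definition cintegral (R : realType) (D : set R) (f : R -> R[i]) : R[i] :=
  (\int[lebesgue_measure]_(t in D) complex.Re (f t)) +i*
  (\int[lebesgue_measure]_(t in D) complex.Im (f t)).

Definition mxintegral (R : realType) (m n : nat) (D : set R)
    (F : R -> 'M[R[i]]_(m, n)) : 'M[R[i]]_(m, n) :=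
  \matrix_(i, j) cintegral D (fun t => F t i j).

Definition gammamx (R : realType) (k : nat) (M : 'M[R[i]]_k) : 'M[R[i]]_k :=
  mxintegral `[0, 1] (fun t : R => expmx (t%:C *: M)).

Section RealL2.
Context {R : realType}.
Local Notation mu := (@lebesgue_measure R).
Local Notation I01 := (`[0%R, 1%R]%classic : set R).
Implicit Types f g : R -> R.

(* f is square integrable on [0, 1] iff its extension by zero is in L^2(R) *)
Definition sqint f : bool := (f \_ I01) \in Lfun mu 2%:E.

Lemma sqint0 : sqint (cst 0).
Proof.
rewrite /sqint (_ : _ \_ _ = 0); last first.
  by apply/funext => x; rewrite patchE; case: ifP.
exact: (Lfun_submod_closed mu (lee1n 2)).1.
Qed.

Lemma sqintZD a f g : sqint f -> sqint g -> sqint (fun x => a * f x + g x).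
Proof.
rewrite /sqint => fL gL.
rewrite (_ : _ \_ _ = a *: (f \_ I01) + g \_ I01).
  exact: (Lfun_submod_closed mu (lee1n 2)).2.
apply/funext => x.
rewrite -[RHS]/(a * (f \_ I01) x + (g \_ I01) x) !patchE; case: ifP => // _.
by rewrite mulr0 addr0.
Qed.

Lemma sqintD f g : sqint f -> sqint g -> sqint (fun x => f x + g x).
Proof.
move=> fL gL; have := sqintZD 1 fL gL.
by under eq_fun do rewrite mul1r.
Qed.

Lemma sqintZ a f : sqint f -> sqint (fun x => a * f x).
Proof.
move=> fL; have := sqintZD a fL sqint0.
by under eq_fun do rewrite addr0.
Qed.

Lemma sqint_bounded f (M : R) : measurable_fun I01 f ->
  (forall x, I01 x -> `|f x| <= M) -> sqint f.
Proof.
move=> mf fM; rewrite /sqint inE; apply/andP; split; rewrite inE/=.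
  by apply/(measurable_restrictT f).
rewrite /finite_norm unlock /Lnorm poweR_lty//.
rewrite [ltLHS](_ : _ = \int[mu]_x (`|(f \_ I01) x| `^ 2)%:E)%E; last first.
  by apply: eq_integral.
apply: (@le_lt_trans _ _ (\int[mu]_x (((cst (M ^+ 2)%R) \_ I01) x)%:E)%E).
  apply: ge0_le_integral => //.
  - apply/measurable_EFinP.
    apply: (@measurableT_comp _ _ _ _ _ _ (@powR R ^~ 2)) => //.
    apply: measurableT_comp => //.
    by apply/(measurable_restrictT f).
  - by apply/measurable_EFinP/(measurable_restrictT (cst (M ^+ 2))).
  - move=> x _ /=; rewrite lee_fin !patchE; case: ifPn => [|_].
      rewrite inE => Dx; rewrite powR_mulrn// ler_sqr ?nnegrE//.
        exact: fM.
      by rewrite (le_trans _ (fM _ Dx)).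
    by rewrite normr0 powR0.
rewrite -[ltLHS]/(\int[mu]_x (EFin \o ((cst (M ^+ 2)%R) \_ I01)) x)%E.
rewrite -restrict_EFin -integral_mkcond.
rewrite -[ltLHS]/(\int[mu]_(x in I01) cst (M ^+ 2)%:E x)%E integral_cst//=.
by rewrite lebesgue_measure_itv/= lte01 oppr0 adde0 mule1 ltry.
Qed.

Lemma sqint_integrable f : sqint f -> mu.-integrable I01 (EFin \o f).
Proof.
move=> fL.
have oneL : sqint (cst 1).
  by apply: (@sqint_bounded _ 1) => // x _; rewrite normr1.
have := Lfun2_mul_Lfun1 fL oneL.
move=> /Lfun1_integrable; rewrite (_ : _ \* _ = f \_ I01); last first.
  apply/funext => x; rewrite /= !patchE; case: ifP => _; by rewrite ?mulr1 ?mulr0.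
rewrite -restrict_EFin => fI; exact/integrable_mkcond.
Qed.

Lemma sqint_integrable_sub f (D : set R) : measurable D -> D `<=` I01 ->
  sqint f -> mu.-integrable D (EFin \o f).
Proof. by move=> mD DI /sqint_integrable; exact: integrableS. Qed.

Lemma sqint_int_l f : sqint f ->
  sqint (fun x => \int[mu]_(t in `[0, x]) f t).
Proof.
move=> fL; have fI := sqint_integrable fL.
apply: (@sqint_bounded _ (\int[mu]_(t in I01) `|f t|)).
  apply: subspace_continuous_measurable_fun => //.
  exact: parameterized_integral_continuous.
move=> x; rewrite /= in_itv/= => /andP[x0 x1].
have sub : `[0, x] `<=` I01.
  by apply: subset_itvl; rewrite bnd_simp.
apply: (le_trans (le_normr_Rintegral _ _)) => //.
  exact: integrableS fI.
have nfI : mu.-integrable I01 (fun t => `|f t|%:E).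
  exact: (@integrable_norm _ _ _ mu _ f).
rewrite /Rintegral fine_le//.
- by apply: integrable_fin_num => //; exact: integrableS nfI.
- exact: integrable_fin_num.
- apply: ge0_subset_integral => //.
  by move/integrableP: nfI => [].
Qed.

Lemma sqint_int_r f : sqint f ->
  sqint (fun x => \int[mu]_(t in `[x, 1]) f t).
Proof.
move=> fL; have fI := sqint_integrable fL.
rewrite /sqint (_ : _ \_ _ = (fun x => \int[mu]_(t in I01) f t +
    - 1 * \int[mu]_(t in `[0, x]) f t) \_ I01).
  apply: sqintD; last exact/sqintZ/sqint_int_l.
  apply: (@sqint_bounded _ `|\int[mu]_(t in I01) f t|) => //.
apply/funext => x; rewrite !patchE; case: ifPn => //.
rewrite inE/= in_itv/= => /andP[x0 x1].
rewrite mulN1r Rintegral_itvB// Rintegral_itv_obnd_cbnd//.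
apply: integrableS fI => //.
by apply: subset_itvr; rewrite bnd_simp.
Qed.

End RealL2.

Lemma ReD (R : realType) (a b : R[i]) :
  complex.Re (a + b) = complex.Re a + complex.Re b.
Proof. by case: a; case: b. Qed.

Lemma ImD (R : realType) (a b : R[i]) :
  complex.Im (a + b) = complex.Im a + complex.Im b.
Proof. by case: a; case: b. Qed.

Lemma ReM (R : realType) (a b : R[i]) : complex.Re (a * b) =
  complex.Re a * complex.Re b + (- complex.Im a) * complex.Im b.
Proof. by case: a => a a'; case: b => b b' /=; rewrite mulNr. Qed.

Lemma ImM (R : realType) (a b : R[i]) : complex.Im (a * b) =
  complex.Re a * complex.Im b + complex.Im a * complex.Re b.
Proof. by case: a => a a'; case: b => b b' /=; rewrite addrC. Qed.

Section ComplexL2.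
Context {R : realType}.
Local Notation mu := (@lebesgue_measure R).
Local Notation I01 := (`[0%R, 1%R]%classic : set R).
Implicit Types f g : R -> R[i].

Definition csqint f : Prop :=
  sqint (fun x => complex.Re (f x)) /\ sqint (fun x => complex.Im (f x)).

Lemma csqint0 : csqint (cst 0).
Proof. by split; exact: sqint0. Qed.

Lemma csqintZ a f : csqint f -> csqint (fun x => a * f x).
Proof.
move=> [fr fi]; split.
  by under eq_fun do rewrite ReM; apply: sqintZD => //; exact: sqintZ.
by under eq_fun do rewrite ImM; apply: sqintZD => //; exact: sqintZ.
Qed.

Lemma csqintD f g : csqint f -> csqint g -> csqint (fun x => f x + g x).
Proof.
move=> [fr fi] [gr gi]; split.
  by under eq_fun do rewrite ReD; exact: sqintD.
by under eq_fun do rewrite ImD; exact: sqintD.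
Qed.

Lemma csqint_sum (I : Type) (r : seq I) (F : I -> R -> R[i]) :
  (forall i, csqint (F i)) -> csqint (fun x => \sum_(i <- r) F i x).
Proof.
move=> FL; elim: r => [|i r IHr].
  by under eq_fun do rewrite big_nil; exact: csqint0.
by under eq_fun do rewrite big_cons; exact: csqintD.
Qed.

Lemma cintegralZD a f g (D : set R) : measurable D -> D `<=` I01 ->
  csqint f -> csqint g ->
  cintegral D (fun x => a * f x + g x) = a * cintegral D f + cintegral D g.
Proof.
move=> mD DI [fr fi] [gr gi]; rewrite /cintegral.
have itg h := @sqint_integrable_sub _ h _ mD DI.
apply/eqP; rewrite eq_complex ReD ImD ReM ImM/=; apply/andP; split; apply/eqP.
  under eq_Rintegral do rewrite ReD ReM.
  rewrite RintegralD//; last 2 first.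
  - by apply/itg/sqintZD => //; exact: sqintZ.
  - exact: itg.
  rewrite RintegralD// ?RintegralZl//; try exact: itg.
  - by apply: itg; exact: sqintZ.
  - by apply: itg; exact: sqintZ.
under eq_Rintegral do rewrite ImD ImM.
rewrite RintegralD//; last 2 first.
- by apply/itg/sqintZD => //; exact: sqintZ.
- exact: itg.
rewrite RintegralD// ?RintegralZl//; try exact: itg.
- by apply: itg; exact: sqintZ.
- by apply: itg; exact: sqintZ.
Qed.

End ComplexL2.

Section L2.
Context (R : realType) (k : nat).
Local Notation mu := (@lebesgue_measure R).
Local Notation I01 := (`[0%R, 1%R]%classic : set R).

Definition sqint_pred : {pred R -> 'cV[R[i]]_k} :=
  mem [set f : R -> 'cV[R[i]]_k | forall i, csqint (fun x => f x i ord0)].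

Lemma sqint_pred_submod_closed : submod_closed sqint_pred.
Proof.
split.
  rewrite inE/= => i; rewrite (_ : (fun _ => _) = cst 0); first exact: csqint0.
  by apply/funext => x; rewrite mxE.
move=> a f g; rewrite !inE/= => fL gL i.
rewrite (_ : (fun _ => _) = fun x => a * f x i ord0 + g x i ord0).
  by apply: csqintD => //; exact: csqintZ.
by apply/funext => x; rewrite !mxE.
Qed.

HB.instance Definition _ := GRing.isSubmodClosed.Build R[i]
  (R -> 'cV[R[i]]_k) sqint_pred sqint_pred_submod_closed.

Record sqintfun := SqintFun {
  sqintfun_fun :> R -> 'cV[R[i]]_k;
  sqintfunP : sqintfun_fun \in sqint_pred }.

HB.instance Definition _ := [isSub for sqintfun_fun].
HB.instance Definition _ := [Choice of sqintfun by <:].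
HB.instance Definition _ := [SubChoice_isSubLmodule of sqintfun by <:].

Definition null_pred : {pred sqintfun} :=
  mem [set f : sqintfun | (f : R -> 'cV[R[i]]_k) = cst 0 %[ae mu in I01]].

Lemma null_pred_submod_closed : submod_closed null_pred.
Proof.
split; first by rewrite inE/=; exact: aeW.
have FF := ae_filter_ringOfSetsType mu.
move=> a f g; rewrite !inE/=; apply: filterS2 => x f0 g0 xI.
by rewrite -[LHS]/(a *: f x + g x) f0// g0//= scaler0 addr0.
Qed.

HB.instance Definition _ := GRing.isSubmodClosed.Build R[i]
  sqintfun null_pred null_pred_submod_closed.

(* L^2([0, 1]; C^k): square integrable functions modulo the functions that
   vanish almost everywhere on [0, 1] *)
Definition L2 : Type := Quotient.quot null_pred.

HB.instance Definition _ := Choice.on L2.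
HB.instance Definition _ := EqQuotient.on L2.
HB.instance Definition _ := GRing.Zmodule.on L2.
HB.instance Definition _ := ZmodQuotient.on L2.

Definition L2_scale (a : R[i]) (p : L2) : L2 := \pi_L2 (a *: repr p).

Lemma L2_eqP (f g : sqintfun) :
  (\pi_L2 f = \pi_L2 g) <->
  ((f : R -> 'cV[R[i]]_k) = (g : R -> 'cV[R[i]]_k) %[ae mu in I01]).
Proof.
have FF := ae_filter_ringOfSetsType mu.
have -> : (\pi_L2 f = \pi_L2 g) <-> f - g \in null_pred.
  rewrite Quotient.idealrBE; split; [by move=> /eqP|by move=> /eqP].
rewrite inE/=; split; apply: filterS => x + xI => /(_ xI) fg.
  by apply: subr0_eq; exact: fg.
by rewrite -[LHS]/(f x - g x) fg subrr.
Qed.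

Lemma pi_L2_scale a f : L2_scale a (\pi_L2 f) = \pi_L2 (a *: f).
Proof.
have FF := ae_filter_ringOfSetsType mu.
apply/L2_eqP; have /L2_eqP := reprK (\pi_L2 f).
apply: filterS => x + xI => /(_ xI) fx.
rewrite -[LHS]/(a *: (repr (\pi_L2 f) : sqintfun) x).
by rewrite -[RHS]/(a *: f x) fx.
Qed.

Lemma pi_L2D f g : \pi_L2 (f + g) = \pi_L2 f + \pi_L2 g.
Proof. by rewrite piE. Qed.

Lemma L2_scaleA a b p : L2_scale a (L2_scale b p) = L2_scale (a * b) p.
Proof. by rewrite -[p]reprK [L2_scale b _]pi_L2_scale !pi_L2_scale scalerA. Qed.

Lemma L2_scale1 : left_id 1 L2_scale.
Proof. by move=> p; rewrite -[p]reprK pi_L2_scale scale1r. Qed.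

Lemma L2_scaleDr : right_distributive L2_scale +%R.
Proof.
move=> a p q; rewrite -[p]reprK -[q]reprK.
by rewrite -pi_L2D !pi_L2_scale -pi_L2D scalerDr.
Qed.

Lemma L2_scaleDl p : {morph L2_scale^~ p : a b / a + b}.
Proof.
move=> a b; rewrite -[p]reprK.
by rewrite !pi_L2_scale -pi_L2D scalerDl.
Qed.

HB.instance Definition _ := GRing.Zmodule_isLmodule.Build R[i] L2
  L2_scaleA L2_scale1 L2_scaleDr L2_scaleDl.

Definition intfun (A B : 'M[R[i]]_k) (p : R -> 'cV[R[i]]_k) : R -> 'cV[R[i]]_k :=
  fun x => A *m mxintegral `[0, x] p + B *m mxintegral `[x, 1] p.

Lemma intfun_sqint A B p : p \in sqint_pred -> intfun A B p \in sqint_pred.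
Proof.
rewrite !inE/= => pL i.
rewrite (_ : (fun _ => _) = fun x =>
    \sum_j A i j * cintegral `[0, x] (fun t => p t j ord0) +
    \sum_j B i j * cintegral `[x, 1] (fun t => p t j ord0)); last first.
  apply/funext => x; rewrite !mxE; congr (_ + _);
  by apply: eq_bigr => j _; rewrite !mxE.
apply: csqintD; apply: csqint_sum => j; apply: csqintZ; have [pr pi] := pL j.
  by split; exact: sqint_int_l.
by split; exact: sqint_int_r.
Qed.

Definition intfun_sqintfun A B (p : sqintfun) : sqintfun :=
  SqintFun (intfun_sqint A B (sqintfunP p)).

(* The integral operator on L^2, computed on a representative of the class *)
Definition intop (A B : 'M[R[i]]_k) (p : L2) : L2 :=
  \pi_L2 (intfun_sqintfun A B (repr p)).

Lemma eq_ae_cintegral (f g : R -> R[i]) (D : set R) : measurable D ->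
  D `<=` I01 -> csqint f -> csqint g ->
  f = g %[ae mu in I01] -> cintegral D f = cintegral D g.
Proof.
move=> mD DI [fr fi] [gr gi] fg; have FF := ae_filter_ringOfSetsType mu.
have mf h : sqint h -> measurable_fun D (EFin \o h).
  by move=> /(sqint_integrable_sub mD DI)/integrableP[].
congr (_ +i* _); congr fine; apply: ae_eq_integral => //; try exact: mf.
  by apply: filterS fg => x + Dx => /(_ (DI _ Dx)) ->.
by apply: filterS fg => x + Dx => /(_ (DI _ Dx)) ->.
Qed.

Lemma sub_itv0x (x : R) : I01 x -> `[0%R, x] `<=` I01.
Proof.
by rewrite /= in_itv/= => /andP[? ?]; apply: subset_itvl; rewrite bnd_simp.
Qed.

Lemma sub_itvx1 (x : R) : I01 x -> `[x, 1%R] `<=` I01.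
Proof.
by rewrite /= in_itv/= => /andP[? ?]; apply: subset_itvr; rewrite bnd_simp.
Qed.

Lemma eq_ae_mxintegral (f g : sqintfun) (D : set R) : measurable D ->
  D `<=` I01 -> (f : R -> 'cV[R[i]]_k) = g %[ae mu in I01] ->
  mxintegral D f = mxintegral D g.
Proof.
have FF := ae_filter_ringOfSetsType mu.
move=> mD DI fg; apply/matrixP => i j; rewrite !mxE (ord1 j).
have := sqintfunP f; have := sqintfunP g; rewrite !inE/= => gL fL.
apply: (eq_ae_cintegral mD DI (fL i) (gL i)).
by apply: filterS fg => x + xI => /(_ xI) ->.
Qed.

Lemma intop_pi A B (f : sqintfun) :
  intop A B (\pi_L2 f) = \pi_L2 (intfun_sqintfun A B f).
Proof.
have /L2_eqP := reprK (\pi_L2 f) => ff.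
apply/L2_eqP; apply: aeW => x xI /=; rewrite /intfun.
congr (_ + _); congr (_ *m _); apply: eq_ae_mxintegral => //.
  exact: sub_itv0x.
exact: sub_itvx1.
Qed.

Lemma mxintegralZD a (f g : sqintfun) (D : set R) : measurable D ->
  D `<=` I01 ->
  mxintegral D (a *: f + g) = a *: mxintegral D f + mxintegral D g.
Proof.
move=> mD DI; apply/matrixP => i j; rewrite !mxE (ord1 j).
have := sqintfunP f; have := sqintfunP g; rewrite !inE/= => gL fL.
rewrite -(cintegralZD a mD DI (fL i) (gL i)).
by congr cintegral; apply/funext => x; rewrite !mxE.
Qed.

Lemma intop_is_linear A B : linear (intop A B).
Proof.
move=> a p q; rewrite -[p]reprK -[q]reprK.
rewrite -[a *: _]/(L2_scale a _) pi_L2_scale -pi_L2D !intop_pi.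
rewrite -[a *: _]/(L2_scale a _) pi_L2_scale -pi_L2D.
apply/L2_eqP; apply: aeW => x xI.
rewrite -[RHS]/(a *: intfun A B (repr p) x + intfun A B (repr q) x).
rewrite /= /intfun !mxintegralZD//; try exact: sub_itv0x; try exact: sub_itvx1.
by rewrite !mulmxDr -!scalemxAr scalerDr addrACA.
Qed.

HB.instance Definition _ A B :=
  GRing.isLinear.Build R[i] L2 L2 _ (intop A B) (intop_is_linear A B).

Definition L2_fun (p : L2) : R -> 'cV[R[i]]_k := (repr p : sqintfun).
Coercion L2_fun : L2 >-> Funclass.

(* The Hilbert norm of L^2([0, 1]; C^k) *)
Definition L2norm (p : L2) : R :=
  Num.sqrt (\int[mu]_(x in I01) \sum_(i < k) Normc.normc (p x i ord0) ^+ 2).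

Lemma L2norm_pi (f : sqintfun) : L2norm (\pi_L2 f) =
  Num.sqrt (\int[mu]_(x in I01) \sum_(i < k) Normc.normc (f x i ord0) ^+ 2).
Proof.
have FF := ae_filter_ringOfSetsType mu.
have mf (g : sqintfun) : measurable_fun I01
    (fun x => (\sum_(i < k) Normc.normc (g x i ord0) ^+ 2)%:E).
  apply/measurable_EFinP.
  apply: (@measurable_sum _ _ _ I01 _ (index_enum _)
    (fun i x => Normc.normc (g x i ord0) ^+ 2)) => i.
  have := sqintfunP g; rewrite inE/= => /(_ i)[gr gi].
  have {}gr : measurable_fun I01 (fun x => complex.Re (g x i ord0)).
    by move: gr => /sqint_integrable/integrableP[/measurable_EFinP].
  have {}gi : measurable_fun I01 (fun x => complex.Im (g x i ord0)).
    by move: gi => /sqint_integrable/integrableP[/measurable_EFinP].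
  rewrite (_ : (fun _ => _) = fun x => complex.Re (g x i ord0) ^+ 2 +
      complex.Im (g x i ord0) ^+ 2); last first.
    apply/funext => x; case: (g x i ord0) => u v /=.
    by rewrite sqr_sqrtr// addr_ge0 ?sqr_ge0.
  by apply: measurable_funD; exact: measurable_funX.
have /L2_eqP := reprK (\pi_L2 f) => ff.
congr Num.sqrt; congr fine; apply: ae_eq_integral => //.
- exact: (mf (repr (\pi_L2 f))).
- exact: mf.
by apply: filterS ff => x + xI => /(_ xI) fx; rewrite /L2_fun fx.
Qed.

Definition bounded_op (S : L2 -> L2) : Prop :=
  exists M : R, forall p, L2norm (S p) <= M * L2norm p.

(* Invertibility as a bounded operator: the inverse has to be bounded *)
Definition invertible_op (S : L2 -> L2) : Prop :=
  exists S' : {linear L2 -> L2},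
    [/\ bounded_op S', cancel S S' & cancel S' S].

Definition spectrum (S : {linear L2 -> L2}) : set R[i] :=
  [set lambda | ~ invertible_op (fun p => S p - lambda *: p)].

Definition eigenfunction (S : L2 -> L2) (lambda : R[i]) (p : L2) : Prop :=
  p != 0 /\ S p = lambda *: p.

Definition Pmx (A B : 'M[R[i]]_k) (lambda : R[i]) : 'M[R[i]]_k :=
  - lambda%:M + B *m gammamx (lambda^-1 *: (A - B)).

End L2.

(* Main.v *)
(* With M = (A - B)/lambda and V p (x) the integral of p over [0, x], one has
   (T - lambda) p = - lambda (1 - M V) p + B (V p)(1) on [0, 1].  The Volterra
   part 1 - M V has the explicit right inverse
     R p (x) = p(x) + M (V p (x) + M e^{xM} V(e^{-tM} V p (t))(x)),
   which involves only primitives of continuous functions.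
   If T p = lambda p, then h := T p / lambda is continuous and h = M V h + d with
   d = B (V h)(1)/lambda, so e^{-xM} h(x) is constant and p = e^{xM} d; and
   (T - lambda)(e^{xM} c) is the constant P c.  When P is invertible,
   (T - lambda)^{-1} g = (e^{xM} d - R g)/lambda with P d = B (V (R g))(1), which
   is bounded since V maps L^2 boundedly to L^oo. *)
From HB Require Import structures.
Require Import Defs.
From mathcomp Require Import all_boot all_order all_algebra.
From mathcomp Require Import all_classical all_reals all_analysis.
From mathcomp Require Import measurable_realfun complex ring lra.

Import Order.TTheory GRing.Theory Num.Theory.
Import numFieldNormedType.Exports.

Local Open Scope classical_set_scope.
Local Open Scope ring_scope.
Local Open Scope complex_scope.

Set Implicit Arguments.
Unset Strict Implicit.
Unset Printing Implicit Defensive.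

(** * Primitives on [0, 1] *)

Section RealPrimitive.
Context {R : realType}.
Local Notation mu := (@lebesgue_measure R).
Local Notation I01 := (`[0%R, 1%R]%classic : set R).
Implicit Types f g F G : R -> R.

(** The derivative is only asked for inside the interval and [F] only has to be continuous up to the
    ends. This suits integrals from 0, which need not have a two-sided derivative at an endpoint,
    and it is the form in which both fundamental theorems of calculus apply. *)
Definition primitive f F :=
  [/\ {within I01, continuous f}, {within I01, continuous F} &
      forall x : R, x \in `]0, 1[ -> is_derive x (1 : R) F (f x)].

Lemma primitiveD f g F G : primitive f F -> primitive g G ->
  primitive (fun x => f x + g x) (fun x => F x + G x).
Proof.
move=> [fc Fc dF] [gc Gc dG]; split.
- by move=> x; apply: cvgD; [exact: fc|exact: gc].
- by move=> x; apply: cvgD; [exact: Fc|exact: Gc].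
- by move=> x x01; apply: is_deriveD; [exact: dF|exact: dG].
Qed.

Lemma primitiveN f F : primitive f F ->
  primitive (fun x => - f x) (fun x => - F x).
Proof.
move=> [fc Fc dF]; split.
- by move=> x; apply: cvgN; exact: fc.
- by move=> x; apply: cvgN; exact: Fc.
- by move=> x x01; apply: is_deriveN; exact: dF.
Qed.

Lemma primitiveM f g F G : primitive f F -> primitive g G ->
  primitive (fun x => f x * G x + F x * g x) (fun x => F x * G x).
Proof.
move=> [fc Fc dF] [gc Gc dG]; split.
- move=> x; apply: cvgD; apply: cvgM;
    [exact: fc|exact: Gc|exact: Fc|exact: gc].
- by move=> x; apply: cvgM; [exact: Fc|exact: Gc].
- move=> x x01; apply: (is_derive_eq (is_deriveM (dF x x01) (dG x x01))).
  by rewrite /GRing.scale/= addrC (mulrC (f x)).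
Qed.

Lemma primitive_cst c : primitive (fun=> 0) (fun=> c).
Proof.
by split=> x; [exact: cvg_cst|exact: cvg_cst|move=> _; exact: is_derive_cst].
Qed.

Lemma primitive_integral f : {within I01, continuous f} ->
  primitive f (fun x => \int[mu]_(t in `[0, x]) f t).
Proof.
move=> fc.
have fI : mu.-integrable I01 (EFin \o f).
  by apply: continuous_compact_integrable => //; exact: segment_compact.
split=> //; first exact: parameterized_integral_continuous.
move=> x; rewrite in_itv/= => /andP[x0 x1].
have fx : {for x, continuous f}.
  have [+ _ _] := (continuous_within_itvP f ltr01).1 fc.
  by apply; rewrite in_itv/= x0 x1.
have [dF <-] := continuous_FTC1_closed x1 fI x0 fx.
by rewrite derive1E; exact: derivableP.
Qed.

Lemma integral_primitive f F x : primitive f F -> 0 <= x -> x <= 1 ->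
  \int[mu]_(t in `[0, x]) f t = F x - F 0.
Proof.
(* The fundamental theorem is applied on a nondegenerate interval, so [x = 0] is settled apart. *)
move=> [fc Fc dF]; rewrite le_eqVlt => /predU1P[<- _|x0 x1].
  by rewrite set_itv1 Rintegral_set1 subrr.
have sub : `[0, x] `<=` I01 by apply: subset_itvl; rewrite bnd_simp.
have sub' : {subset `]0, x[ <= `]0, 1[}.
  by apply: subset_itvW.
rewrite /Rintegral (@continuous_FTC2 _ f F)//.
- exact: continuous_subspaceW fc.
- have /(continuous_within_itvP _ x0)[_ ? ?] := continuous_subspaceW sub Fc.
  by split=> // y /sub'/dF.
- by move=> y /sub'/dF/(@derive_val _ _ _ _ _ _ _); rewrite derive1E.
Qed.

End RealPrimitive.

Lemma eq_within_continuous {R : realType} (A : set R) (f g : R -> R) :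
  f =1 g -> {within A, continuous f} -> {within A, continuous g}.
Proof. by move=> /funext->. Qed.

Lemma eq_primitive {R : realType} (f F g G : R -> R) :
  f =1 g -> F =1 G -> primitive f F -> primitive g G.
Proof. by move=> /funext-> /funext->. Qed.

(** * Complex and matrix-valued primitives *)

Section MatrixPrimitive.
Context {R : realType}.
Local Notation I01 := (`[0%R, 1%R]%classic : set R).

Definition ccontinuous (f : R -> R[i]) :=
  {within I01, continuous (fun x => complex.Re (f x))} /\
  {within I01, continuous (fun x => complex.Im (f x))}.

Definition cprimitive (f F : R -> R[i]) :=
  primitive (fun x => complex.Re (f x)) (fun x => complex.Re (F x)) /\
  primitive (fun x => complex.Im (f x)) (fun x => complex.Im (F x)).

Lemma ccontinuousD f g : ccontinuous f -> ccontinuous g ->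
  ccontinuous (fun x => f x + g x).
Proof.
move=> [fr fi] [gr gi]; split.
  apply: (eq_within_continuous (fun x => esym (ReD (f x) (g x)))) => x.
  by apply: cvgD; [exact: fr|exact: gr].
apply: (eq_within_continuous (fun x => esym (ImD (f x) (g x)))) => x.
by apply: cvgD; [exact: fi|exact: gi].
Qed.

Lemma ccontinuousM f g : ccontinuous f -> ccontinuous g ->
  ccontinuous (fun x => f x * g x).
Proof.
move=> [fr fi] [gr gi]; split.
  apply: (eq_within_continuous (fun x => esym (Defs.ReM (f x) (g x)))) => x.
  apply: cvgD; apply: cvgM; [exact: fr|exact: gr| |exact: gi].
  by apply: cvgN; exact: fi.
apply: (eq_within_continuous (fun x => esym (Defs.ImM (f x) (g x)))) => x.
by apply: cvgD; apply: cvgM; [exact: fr|exact: gi|exact: fi|exact: gr].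
Qed.

Lemma ccontinuous_cst c : ccontinuous (fun=> c).
Proof. by split=> x; exact: cvg_cst. Qed.

Lemma ccontinuous_sum (I : Type) (r : seq I) (f : I -> R -> R[i]) :
  (forall i, ccontinuous (f i)) -> ccontinuous (fun x => \sum_(i <- r) f i x).
Proof.
move=> fc; elim: r => [|i r IHr].
  by under eq_fun do rewrite big_nil; exact: ccontinuous_cst.
by under eq_fun do rewrite big_cons; exact: ccontinuousD.
Qed.

Lemma eq_ccontinuous f g : f =1 g -> ccontinuous f -> ccontinuous g.
Proof. by move=> /funext->. Qed.

Lemma eq_cprimitive f F g G :
  f =1 g -> F =1 G -> cprimitive f F -> cprimitive g G.
Proof. by move=> /funext-> /funext->. Qed.

Lemma cprimitiveD f g F G : cprimitive f F -> cprimitive g G ->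
  cprimitive (fun x => f x + g x) (fun x => F x + G x).
Proof.
move=> [fr fi] [gr gi]; split.
  by apply: eq_primitive (primitiveD fr gr) => x; rewrite ReD.
by apply: eq_primitive (primitiveD fi gi) => x; rewrite ImD.
Qed.

Lemma cprimitiveM f g F G : cprimitive f F -> cprimitive g G ->
  cprimitive (fun x => f x * G x + F x * g x) (fun x => F x * G x).
Proof.
move=> [fr fi] [gr gi]; split.
  apply: eq_primitive (primitiveD (primitiveM fr gr)
    (primitiveM (primitiveN fi) gi)) => x; last by rewrite Defs.ReM.
  by rewrite ReD !Defs.ReM addrACA.
apply: eq_primitive (primitiveD (primitiveM fr gi) (primitiveM fi gr)) => x.
  by rewrite ImD !Defs.ImM addrACA.
by rewrite Defs.ImM.
Qed.

Lemma cprimitive_cst c : cprimitive (fun=> 0) (fun=> c).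
Proof. by split; exact: primitive_cst. Qed.

Lemma cprimitive_sum (I : Type) (r : seq I) (f F : I -> R -> R[i]) :
  (forall i, cprimitive (f i) (F i)) ->
  cprimitive (fun x => \sum_(i <- r) f i x) (fun x => \sum_(i <- r) F i x).
Proof.
move=> fF; elim: r => [|i r IHr].
  by apply: eq_cprimitive (cprimitive_cst 0) => x; rewrite big_nil.
by apply: eq_cprimitive (cprimitiveD (fF i) IHr) => x; rewrite big_cons.
Qed.

Definition mxcontinuous m n (f : R -> 'M[R[i]]_(m, n)) :=
  forall i j, ccontinuous (fun x => f x i j).

Definition mxprimitive m n (f F : R -> 'M[R[i]]_(m, n)) :=
  forall i j, cprimitive (fun x => f x i j) (fun x => F x i j).

Lemma mxcontinuousD m n (f g : R -> 'M[R[i]]_(m, n)) :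
  mxcontinuous f -> mxcontinuous g -> mxcontinuous (fun x => f x + g x).
Proof.
move=> fc gc i j.
by apply: eq_ccontinuous (ccontinuousD (fc i j) (gc i j)) => x; rewrite mxE.
Qed.

Lemma mxcontinuousM m n p (f : R -> 'M[R[i]]_(m, n))
    (g : R -> 'M[R[i]]_(n, p)) :
  mxcontinuous f -> mxcontinuous g -> mxcontinuous (fun x => f x *m g x).
Proof.
move=> fc gc i j.
have /eq_ccontinuous := ccontinuous_sum (index_enum 'I_n)
  (fun l => ccontinuousM (fc i l) (gc l j)).
by apply=> x; rewrite mxE.
Qed.

Lemma mxcontinuous_cst m n (c : 'M[R[i]]_(m, n)) : mxcontinuous (fun=> c).
Proof. by move=> i j; exact: ccontinuous_cst. Qed.

Lemma mxprimitive_continuous m n (f F : R -> 'M[R[i]]_(m, n)) :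
  mxprimitive f F -> mxcontinuous F.
Proof. by move=> fF i j; have [[_ ? _] [_ ? _]] := fF i j. Qed.

Lemma eq_mxprimitive m n (f F g G : R -> 'M[R[i]]_(m, n)) :
  f =1 g -> F =1 G -> mxprimitive f F -> mxprimitive g G.
Proof. by move=> /funext-> /funext->. Qed.

Lemma mxprimitiveD m n (f g F G : R -> 'M[R[i]]_(m, n)) :
  mxprimitive f F -> mxprimitive g G ->
  mxprimitive (fun x => f x + g x) (fun x => F x + G x).
Proof.
move=> fF gG i j.
by apply: eq_cprimitive (cprimitiveD (fF i j) (gG i j)) => x; rewrite mxE.
Qed.

Lemma mxprimitiveM m n p (f F : R -> 'M[R[i]]_(m, n))
    (g G : R -> 'M[R[i]]_(n, p)) :
  mxprimitive f F -> mxprimitive g G ->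
  mxprimitive (fun x => f x *m G x + F x *m g x) (fun x => F x *m G x).
Proof.
move=> fF gG i j.
have /eq_cprimitive := cprimitive_sum (index_enum 'I_n)
  (fun l => cprimitiveM (fF i l) (gG l j)).
by apply=> x; rewrite !mxE// -big_split.
Qed.

Lemma mxprimitive_cst m n (c : 'M[R[i]]_(m, n)) :
  mxprimitive (fun=> 0) (fun=> c).
Proof.
by move=> i j; apply: eq_cprimitive (cprimitive_cst (c i j)) => x; rewrite ?mxE.
Qed.

(** The operator V of the overview. *)
Definition volterra m n (f : R -> 'M[R[i]]_(m, n)) (x : R) :=
  mxintegral `[0, x] f.

Lemma volterra0 m n (f : R -> 'M[R[i]]_(m, n)) : volterra f 0 = 0.
Proof.
by apply/matrixP => i j; rewrite !mxE /cintegral set_itv1 !Rintegral_set1.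
Qed.

Lemma mxprimitive_volterra m n (f : R -> 'M[R[i]]_(m, n)) :
  mxcontinuous f -> mxprimitive f (volterra f).
Proof.
move=> fc i j; have [fr fi] := fc i j.
by split; [move: (primitive_integral fr)|move: (primitive_integral fi)];
  apply: eq_primitive => // x; rewrite mxE.
Qed.

(** Every integral below is evaluated by exhibiting a primitive and quoting this fact. With [f = 0]
    it also says that a function with zero derivative is constant. *)
Lemma volterra_primitive m n (f F : R -> 'M[R[i]]_(m, n)) x :
  mxprimitive f F -> I01 x -> volterra f x = F x - F 0.
Proof.
rewrite /= in_itv/= => fF /andP[x0 x1].
apply/matrixP => i j; have [fr fi] := fF i j.
rewrite !mxE /cintegral (integral_primitive fr)// (integral_primitive fi)//.
by case: (F x i j) => a b; case: (F 0 i j).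
Qed.

Lemma eq_volterra m n (f g : R -> 'M[R[i]]_(m, n)) x : I01 x ->
  (forall t, I01 t -> f t = g t) -> volterra f x = volterra g x.
Proof.
rewrite /= in_itv/= => /andP[x0 x1] fg; apply/matrixP => i j; rewrite !mxE.
by congr (_ +i* _); apply: eq_Rintegral => t /[!inE]/=;
  rewrite in_itv/= => /andP[t0 tx]; rewrite fg// in_itv/= t0 (le_trans tx).
Qed.

End MatrixPrimitive.

(** * Matrix exponential *)

Section MatrixAbs.
Context {R : realType}.
Implicit Types z w : R[i].

(** The l^1 norm on C = R^2, taken instead of the modulus: it is real-valued, submultiplicative, and
    bounds real and imaginary parts without square roots. *)
Definition cabs z : R := `|complex.Re z| + `|complex.Im z|.

Lemma cabs_ge0 z : 0 <= cabs z.
Proof. by rewrite addr_ge0. Qed.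

Lemma cabs0 : cabs 0 = 0.
Proof. by rewrite /cabs /= normr0 addr0. Qed.

Lemma cabsD z w : cabs (z + w) <= cabs z + cabs w.
Proof. by rewrite /cabs ReD ImD addrACA lerD// ler_normD. Qed.

Lemma cabsM z w : cabs (z * w) <= cabs z * cabs w.
Proof.
rewrite /cabs Defs.ReM Defs.ImM.
apply: le_trans (lerD (ler_normD _ _) (ler_normD _ _)) _.
by rewrite !normrM normrN; lra.
Qed.

Lemma cabs_sum (I : Type) (r : seq I) (F : I -> R[i]) :
  cabs (\sum_(i <- r) F i) <= \sum_(i <- r) cabs (F i).
Proof.
elim: r => [|i r IHr]; first by rewrite !big_nil cabs0.
by rewrite !big_cons (le_trans (cabsD _ _))// lerD2l.
Qed.

Definition mxabs m n (A : 'M[R[i]]_(m, n)) : R :=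
  \sum_i \sum_j cabs (A i j).

Lemma mxabs_ge0 m n (A : 'M[R[i]]_(m, n)) : 0 <= mxabs A.
Proof. by apply: sumr_ge0 => i _; apply: sumr_ge0 => j _; exact: cabs_ge0. Qed.

Lemma cabs_le_mxabs m n (A : 'M[R[i]]_(m, n)) i j : cabs (A i j) <= mxabs A.
Proof.
rewrite /mxabs (bigD1 i)//= (bigD1 j)//= -addrA lerDl addr_ge0//.
  by apply: sumr_ge0 => *; exact: cabs_ge0.
by apply: sumr_ge0 => *; apply: sumr_ge0 => *; exact: cabs_ge0.
Qed.

Lemma mxabsD m n (A B : 'M[R[i]]_(m, n)) :
  mxabs (A + B) <= mxabs A + mxabs B.
Proof.
rewrite /mxabs -big_split; apply: ler_sum => i _.
rewrite -big_split; apply: ler_sum => j _.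
by rewrite mxE; exact: cabsD.
Qed.

Lemma mxabsM m n p (A : 'M[R[i]]_(m, n)) (B : 'M[R[i]]_(n, p)) :
  mxabs (A *m B) <= mxabs A * mxabs B.
Proof.
rewrite /mxabs mulr_suml; apply: ler_sum => i _.
apply: (@le_trans _ _ (\sum_j \sum_l cabs (A i l) * cabs (B l j))).
  apply: ler_sum => j _; rewrite mxE (le_trans (cabs_sum _ _))//.
  by apply: ler_sum => l _; exact: cabsM.
rewrite exchange_big mulr_suml; apply: ler_sum => l _.
(* Row [l] of [B] is one of the rows summed in [mxabs B]. *)
rewrite -mulr_sumr ler_wpM2l ?cabs_ge0// (bigD1 l)//= lerDl.
by apply: sumr_ge0 => *; apply: sumr_ge0 => *; exact: cabs_ge0.
Qed.

End MatrixAbs.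

(** * Exponential generating functions and limits of matrices *)

Section ExponentialSeries.
Context {R : realType}.

(** Growth condition met by the entries of the powers of a matrix. It is stable under the shift of
    the sequence and makes the series of [a n * x ^ n / n!] converge for every [x]. *)
Definition geometric_bound (a : nat -> R) :=
  exists K r : R, [/\ 0 <= K, 0 <= r & forall n, `|a n| <= K * r ^+ n].

Lemma geometric_boundS a :
  geometric_bound a -> geometric_bound (fun n => a n.+1).
Proof.
move=> [K [r [K0 r0 aK]]]; exists (K * r), r; split => //.
  exact: mulr_ge0.
by move=> n; rewrite -mulrA -exprS.
Qed.

Definition egf (a : nat -> R) (x : R) : R :=
  limn (pseries (fun n => n`!%:R^-1 * a n) x).

(** Comparison with the series of K exp(r |x|). *)
Lemma is_cvg_egf a x : geometric_bound a ->
  cvgn (pseries (fun n => n`!%:R^-1 * a n) x).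
Proof.
move=> [K [r [K0 r0 aK]]]; apply: normed_cvg.
apply: (@series_le_cvg _ _ (K *: exp_coeff (r * `|x|))) => //.
- by move=> n; exact: normr_ge0.
- by move=> n; apply: mulr_ge0 => //; apply: exp_coeff_ge0; exact: mulr_ge0.
- move=> n /=; rewrite !normrM normfV !normr_nat normrX.
  rewrite -[leRHS]/(K * exp_coeff _ n) exp_coeffE exprMn.
  rewrite [leRHS]mulrCA -mulrA ler_wpM2l ?invr_ge0//.
  by rewrite mulrA ler_wpM2r ?exprn_ge0.
- exact/is_cvg_seriesZ/is_cvg_series_exp_coeff.
Qed.

(** Formal differentiation of an exponential generating function shifts its sequence, because
    (n+1)/(n+1)! = 1/n!. *)
Lemma egf_diffs (a : nat -> R) : pseries_diffs (fun n => n`!%:R^-1 * a n) =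
  (fun n => n`!%:R^-1 * a n.+1).
Proof.
apply/funext => n; rewrite /pseries_diffs mulrA; congr (_ * _).
by rewrite factS natrM invfM mulVKf// pnatr_eq0.
Qed.

Lemma is_derive_egf a x : geometric_bound a ->
  is_derive x (1 : R) (egf a) (egf (fun n => a n.+1) x).
Proof.
move=> aK; have a1K := geometric_boundS aK; have a2K := geometric_boundS a1K.
(* Termwise differentiation at [x] asks for convergence of the series and of its first two formal
   derivatives at a point of larger modulus; [|x| + 1] serves. *)
rewrite /egf -egf_diffs; apply: (@pseries_snd_diffs _ _ (`|x| + 1)).
- exact: is_cvg_egf.
- by rewrite egf_diffs; exact: is_cvg_egf.
- by rewrite !egf_diffs; exact: is_cvg_egf.
- by rewrite [ltRHS]ger0_norm ?addr_ge0// ltrDl.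
Qed.

Lemma egf_continuous a (A : set R) : geometric_bound a ->
  {within A, continuous (egf a)}.
Proof.
move=> aK; apply: continuous_subspaceT => x.
have [] := is_derive_egf x aK => + _.
by move=> /derivable1_diffP/differentiable_continuous.
Qed.

Lemma primitive_egf a : geometric_bound a ->
  primitive (egf (fun n => a n.+1)) (egf a).
Proof.
move=> aK; split; [|exact: egf_continuous|].
  exact/egf_continuous/geometric_boundS.
by move=> x _; exact: is_derive_egf.
Qed.

Lemma cReB (z w : R[i]) : complex.Re (z - w) = complex.Re z - complex.Re w.
Proof. by case: z; case: w. Qed.

Lemma cImB (z w : R[i]) : complex.Im (z - w) = complex.Im z - complex.Im w.
Proof. by case: z; case: w. Qed.

Lemma cvg_complex (u : nat -> R[i]) (l : R[i]) :
  (fun n => complex.Re (u n)) @ \oo --> complex.Re l ->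
  (fun n => complex.Im (u n)) @ \oo --> complex.Im l ->
  u @ \oo --> l.
Proof.
move=> /cvgrPdist_lt ur /cvgrPdist_lt ui.
(* A positive element of [R[i]] is real, so the radius is a real [e]; bounds by [e / 2] on both
   parts suffice. *)
apply/cvgrPdist_lt => -[e e'] /[!ltcE]/= /andP[/eqP-> e0].
near=> n; rewrite normc_def ltcR.
have ur' : `|complex.Re l - complex.Re (u n)| < e / 2.
  by near: n; apply: ur; rewrite divr_gt0.
have ui' : `|complex.Im l - complex.Im (u n)| < e / 2.
  by near: n; apply: ui; rewrite divr_gt0.
rewrite -[e]ger0_norm ?ltW// -sqrtr_sqr ltr_sqrt ?exprn_gt0//.
rewrite (cReB l) (cImB l).
rewrite -real_normK ?num_real// -[X in _ + X]real_normK ?num_real//.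
have := normr_ge0 (complex.Re l - complex.Re (u n)).
have := normr_ge0 (complex.Im l - complex.Im (u n)).
nra.
Unshelve. all: by end_near. Qed.

Lemma cvg_mxP m n (u : nat -> 'M[R[i]]_(m, n)) (l : 'M[R[i]]_(m, n)) :
  u @ \oo --> l <-> forall i j, (fun N => u N i j) @ \oo --> l i j.
Proof.
split=> [ul i j P lP|ul].
  have : nbhs l [set A : 'M[R[i]]_(m, n) | P (A i j)].
    (* A product neighbourhood that constrains the entry (i, j) alone. *)
    exists (fun i' j' => [set z | (i' == i) && (j' == j) -> P z]).
      move=> i' j'; case: (eqVneq i' i) => [->|]/=; last first.
        by move=> _; exact: filterE.
      case: (eqVneq j' j) => [->|]/=; last by move=> _; exact: filterE.
      by apply: filterS lP => z ? _.
    by move=> A /(_ i j); apply; rewrite !eqxx.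
  by move=> /ul.
move=> P [Q lQ QP]; have : \forall N \near \oo, forall i j, Q i j (u N i j).
  by apply: filter_forall => i; apply: filter_forall => j; exact: ul.
by apply: filterS => N /= QN; exact: QP.
Qed.

Lemma cvg_mx_unique m n (u : nat -> 'M[R[i]]_(m, n)) (l l' : 'M[R[i]]_(m, n)) :
  u @ \oo --> l -> u @ \oo --> l' -> l = l'.
Proof.
move=> /cvg_mxP ul /cvg_mxP ul'; apply/matrixP => i j.
exact: (cvg_unique _ (ul i j) (ul' i j)).
Qed.

Lemma cvg_mulmx m n p (u : nat -> 'M[R[i]]_(m, n)) (v : nat -> 'M[R[i]]_(n, p))
    (l : 'M[R[i]]_(m, n)) (l' : 'M[R[i]]_(n, p)) :
  u @ \oo --> l -> v @ \oo --> l' -> (fun N => u N *m v N) @ \oo --> l *m l'.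
Proof.
move=> /cvg_mxP ul /cvg_mxP vl; apply/cvg_mxP => i j.
rewrite mxE (_ : (fun _ => _) = fun N => \sum_h u N i h * v N h j); last first.
  by apply/funext => N; rewrite mxE.
apply: cvg_big => [|h _]; first exact: add_continuous.
by apply: cvgM; [exact: ul|exact: vl].
Qed.

End ExponentialSeries.

(** * The exponential as a power series in a real variable *)

Section MatrixExponential.
Context {R : realType}.
Local Notation I01 := (`[0%R, 1%R]%classic : set R).

(** The sum of [N l * x ^ l / l!], written entry by entry so that the real calculus of [egf]
    applies; [N l = M ^+ l] gives e^{xM}. *)
Definition mxegf m n (N : nat -> 'M[R[i]]_(m, n)) (x : R) : 'M[R[i]]_(m, n) :=
  \matrix_(i, j) (egf (fun l => complex.Re (N l i j)) x +i*
                  egf (fun l => complex.Im (N l i j)) x).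

Definition mxgeometric_bound m n (N : nat -> 'M[R[i]]_(m, n)) :=
  exists K r : R, [/\ 0 <= K, 0 <= r & forall l, mxabs (N l) <= K * r ^+ l].

Lemma mxgeometric_bound_entry m n (N : nat -> 'M[R[i]]_(m, n)) i j :
  mxgeometric_bound N ->
  geometric_bound (fun l => complex.Re (N l i j)) /\
  geometric_bound (fun l => complex.Im (N l i j)).
Proof.
move=> [K [r [K0 r0 NK]]]; split; exists K, r; split => // l.
  apply: le_trans (NK l); apply: le_trans (cabs_le_mxabs _ i j).
  by rewrite lerDl.
apply: le_trans (NK l); apply: le_trans (cabs_le_mxabs _ i j).
by rewrite lerDr.
Qed.

Lemma mxprimitive_egf m n (N : nat -> 'M[R[i]]_(m, n)) :
  mxgeometric_bound N ->
  mxprimitive (mxegf (fun l => N l.+1)) (mxegf N).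
Proof.
move=> NK i j; have [rK iK] := mxgeometric_bound_entry i j NK.
by split; [apply: eq_primitive (primitive_egf rK)|
  apply: eq_primitive (primitive_egf iK)] => x; rewrite mxE.
Qed.

Lemma mxegf_cvg m n (N : nat -> 'M[R[i]]_(m, n)) x :
  mxgeometric_bound N ->
  (fun p => \sum_(0 <= l < p) (l`!%:R^-1 * x ^+ l)%:C *: N l) @ \oo -->
  mxegf N x.
Proof.
move=> NK; apply/cvg_mxP => i j.
have [rK iK] := mxgeometric_bound_entry i j NK.
rewrite mxE; apply: cvg_complex => /=.
  rewrite (_ : (fun _ => _) =
    pseries (fun l => l`!%:R^-1 * complex.Re (N l i j)) x).
    exact: (is_cvg_egf rK).
  apply/funext => p; rewrite summxE.
  rewrite (big_morph (@complex.Re R) (@Defs.ReD R) (erefl _)).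
  by apply: eq_bigr => l _; rewrite mxE Defs.ReM/= oppr0 mul0r addr0 mulrAC.
rewrite (_ : (fun _ => _) =
  pseries (fun l => l`!%:R^-1 * complex.Im (N l i j)) x).
  exact: (is_cvg_egf iK).
apply/funext => p; rewrite summxE.
rewrite (big_morph (@complex.Im R) (@Defs.ImD R) (erefl _)).
by apply: eq_bigr => l _; rewrite mxE Defs.ImM/= mul0r addr0 mulrAC.
Qed.

Lemma mxexp_geometric_bound k (M : 'M[R[i]]_k) :
  mxgeometric_bound (fun l => M ^+ l).
Proof.
(* The constant is the size of the identity, which for this entry sum is [k] and not 1. *)
exists (mxabs (1%:M : 'M[R[i]]_k)), (mxabs M); split; try exact: mxabs_ge0.
elim=> [|l IHl]; first by rewrite !expr0 mulr1.
rewrite !exprSr mulrA -[M ^+ l * M]/(M ^+ l *m M) (le_trans (mxabsM _ _))//.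
by rewrite ler_wpM2r// mxabs_ge0.
Qed.

Lemma exprZmx k (a : R[i]) (M : 'M[R[i]]_k) l :
  (a *: M) ^+ l = a ^+ l *: M ^+ l.
Proof.
elim: l => [|l IHl]; first by rewrite !expr0 scale1r.
rewrite !exprS IHl -[LHS]/((a *: M) *m (a ^+ l *: M ^+ l)).
by rewrite -scalemxAl -scalemxAr scalerA.
Qed.

Lemma expmxE k (M : 'M[R[i]]_k) (x : R) :
  expmx (x%:C *: M) = mxegf (fun l => M ^+ l) x.
Proof.
have cvgE := mxegf_cvg (x := x) (mxexp_geometric_bound M).
have serE : (fun p => \sum_(0 <= l < p) (l`!%:R^-1 * x ^+ l)%:C *: M ^+ l) =
    [series (j`!%:R)^-1 *: (x%:C *: M) ^+ j]_j.
  apply/funext => p; apply: eq_bigr => l _ /=.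
  by rewrite exprZmx scalerA rmorphM rmorphXn/= fmorphV rmorph_nat.
rewrite serE in cvgE; apply: cvg_mx_unique (cvgE).
(* [expmx] is a [limn], which is a true limit only once the series is known to converge. *)
by rewrite /expmx; apply/cvg_ex; exists (mxegf (fun l => M ^+ l) x).
Qed.

Lemma mxgeometric_boundM m n p (A : 'M[R[i]]_(m, n))
    (N : nat -> 'M[R[i]]_(n, p)) :
  mxgeometric_bound N -> mxgeometric_bound (fun l => A *m N l).
Proof.
move=> [K [r [K0 r0 NK]]]; exists (mxabs A * K), r; split => //.
  by rewrite mulr_ge0// mxabs_ge0.
by move=> l; rewrite (le_trans (mxabsM _ _))// -mulrA ler_wpM2l// mxabs_ge0.
Qed.

Lemma mxegf_mulmx m n p (A : 'M[R[i]]_(m, n)) (N : nat -> 'M[R[i]]_(n, p)) x :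
  mxgeometric_bound N -> mxegf (fun l => A *m N l) x = A *m mxegf N x.
Proof.
move=> NK.
have cA : (fun=> A) @ \oo --> A by exact: cvg_cst.
apply/esym; apply: cvg_mx_unique (cvg_mulmx cA (mxegf_cvg (x := x) NK)) _.
rewrite (_ : (fun _ => _) = fun p =>
    \sum_(0 <= l < p) (l`!%:R^-1 * x ^+ l)%:C *: (A *m N l)).
  exact/mxegf_cvg/mxgeometric_boundM.
by apply/funext => q; rewrite mulmx_sumr; under eq_bigr do rewrite -scalemxAr.
Qed.

Lemma mxegfr_mulmx k (M : 'M[R[i]]_k) x :
  mxegf (fun l => M ^+ l *m M) x = mxegf (fun l => M ^+ l) x *m M.
Proof.
have NK := mxexp_geometric_bound M.
have cM : (fun=> M) @ \oo --> M by exact: cvg_cst.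
apply/esym; apply: cvg_mx_unique (cvg_mulmx (mxegf_cvg (x := x) NK) cM) _.
rewrite (_ : (fun _ => _) = fun p =>
    \sum_(0 <= l < p) (l`!%:R^-1 * x ^+ l)%:C *: (M *m M ^+ l)).
  have -> : (fun l => M ^+ l *m M) = (fun l => M *m M ^+ l).
    by apply/funext => l; rewrite -[LHS]exprSr exprS.
  exact/mxegf_cvg/mxgeometric_boundM.
apply/funext => q; rewrite mulmx_suml; apply: eq_bigr => l _.
by rewrite -scalemxAl -[M *m _]exprS exprSr.
Qed.

Lemma expmx_comm k (M : 'M[R[i]]_k) (x : R) :
  M *m expmx (x%:C *: M) = expmx (x%:C *: M) *m M.
Proof.
rewrite expmxE -mxegf_mulmx; last exact: mxexp_geometric_bound.
rewrite -mxegfr_mulmx; congr mxegf; apply/funext => l.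
by rewrite -[LHS]exprS exprSr.
Qed.

(** Differentiation shifts the sequence [M ^+ l], and the shift is left multiplication by [M]. *)
Lemma mxprimitive_expmx k (M : 'M[R[i]]_k) :
  mxprimitive (fun x : R => M *m expmx (x%:C *: M))
    (fun x => expmx (x%:C *: M)).
Proof.
have := mxprimitive_egf (mxexp_geometric_bound M).
apply: eq_mxprimitive => x; rewrite expmxE//.
rewrite -mxegf_mulmx; last exact: mxexp_geometric_bound.
by congr mxegf; apply/funext => l; rewrite exprS.
Qed.

Lemma expmx0 k (M : 'M[R[i]]_k) : expmx ((0 : R)%:C *: M) = 1%:M.
Proof.
rewrite expmxE; apply: cvg_mx_unique (mxegf_cvg (mxexp_geometric_bound M)) _.
(* At [x = 0] only the term [l = 0] survives; the empty partial sum is 0, so the partial sums are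
   constant from index 1 on. *)
apply: cvg_near_cst; exists 1%N => // -[//|p _] /=.
rewrite big_nat_recl// big1 => [|l _]; last first.
  by rewrite expr0n mulr0 scale0r.
by rewrite fact0 invr1 mul1r !expr0 scale1r addr0.
Qed.

(** As [M] commutes with e^{xM}, the product e^{xM} e^{-xM} has zero derivative, so on [0, 1] it
    keeps its value at 0. *)
Lemma expmx_mulN k (M : 'M[R[i]]_k) (x : R) : I01 x ->
  expmx (x%:C *: M) *m expmx (x%:C *: - M) = 1%:M.
Proof.
move=> xI.
have P0 : mxprimitive (fun=> 0)
    (fun y : R => expmx (y%:C *: M) *m expmx (y%:C *: - M)).
  apply: eq_mxprimitive
    (mxprimitiveM (mxprimitive_expmx M) (mxprimitive_expmx (- M))) => // y.
  by rewrite expmx_comm mulmxA mulmxN mulNmx addrN.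
have := volterra_primitive P0 xI.
rewrite (volterra_primitive (mxprimitive_cst (0 : 'M[R[i]]_k)) xI) subrr.
by move=> /esym/subr0_eq ->; rewrite !expmx0 mulmx1.
Qed.

End MatrixExponential.

(** * Volterra operator *)

Section VectorIntegral.
Context {R : realType} {k : nat}.
Local Notation mu := (@lebesgue_measure R).
Local Notation I01 := (`[0%R, 1%R]%classic : set R).
Implicit Types f g p : R -> 'cV[R[i]]_k.

Definition sqintmx f := forall i, csqint (fun x => f x i ord0).

Lemma sqintmxP f : reflect (sqintmx f) (f \in @sqint_pred R k).
Proof. by apply: (iffP idP); rewrite inE. Qed.

Lemma eq_csqint (u v : R -> R[i]) : u =1 v -> csqint u -> csqint v.
Proof. by move=> /funext->. Qed.

Lemma sqintmxD f g : sqintmx f -> sqintmx g -> sqintmx (fun x => f x + g x).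
Proof.
move=> fL gL i; apply: eq_csqint (csqintD (fL i) (gL i)) => x.
by rewrite mxE.
Qed.

Lemma sqintmx_mulmx (A : 'M[R[i]]_k) f :
  sqintmx f -> sqintmx (fun x => A *m f x).
Proof.
move=> fL i.
have /eq_csqint := csqint_sum (index_enum 'I_k)
  (fun j => csqintZ (A i j) (fL j)).
by apply=> x; rewrite mxE.
Qed.

Lemma mxcontinuous_bounded m n (f : R -> 'M[R[i]]_(m, n)) : mxcontinuous f ->
  exists2 C, 0 <= C & forall x, I01 x -> mxabs (f x) <= C.
Proof.
move=> fc.
have nfc : {within I01, continuous (fun x => mxabs (f x))}.
  move=> x; apply: cvg_big => [|i _]; first exact: add_continuous.
  apply: cvg_big => [|j _]; first exact: add_continuous.
  have [fr fi] := fc i j.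
  by apply: cvgD; apply: cvg_norm; [exact: fr|exact: fi].
have [c _ fcmax] := EVT_max ler01 nfc.
exists (mxabs (f c)); first exact: mxabs_ge0.
by move=> x xI; exact: fcmax.
Qed.

Lemma mxcontinuous_sqint f : mxcontinuous f -> sqintmx f.
Proof.
move=> fc i; have [C C0 fC] := mxcontinuous_bounded fc.
have [fr fi] := fc i ord0.
split; apply: (@sqint_bounded _ _ C).
- exact: subspace_continuous_measurable_fun.
- move=> x /fC; apply: le_trans; apply: le_trans (cabs_le_mxabs _ i ord0).
  by rewrite lerDl.
- exact: subspace_continuous_measurable_fun.
- move=> x /fC; apply: le_trans; apply: le_trans (cabs_le_mxabs _ i ord0).
  by rewrite lerDr.
Qed.

Section SubInterval.
Variable D : set R.
Hypotheses (mD : measurable D) (DI : D `<=` I01).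

Lemma mxintegralD f g : sqintmx f -> sqintmx g ->
  mxintegral D (fun x => f x + g x) = mxintegral D f + mxintegral D g.
Proof.
move=> fL gL; apply/matrixP => i j; rewrite !mxE (ord1 j).
rewrite -[X in X + _]mul1r -cintegralZD//.
by congr cintegral; apply/funext => x; rewrite mxE mul1r.
Qed.

Lemma cintegral0 : cintegral D (fun=> 0) = 0 :> R[i].
Proof. by rewrite /cintegral Rintegral_cst// mul0r. Qed.

Lemma mxintegral_mulmx (A : 'M[R[i]]_k) f : sqintmx f ->
  mxintegral D (fun x => A *m f x) = A *m mxintegral D f.
Proof.
move=> fL; apply/matrixP => i j; rewrite !mxE (ord1 j).
under [RHS]eq_bigr do rewrite mxE.
rewrite (_ : (fun _ => _) = fun x => \sum_l A i l * f x l ord0); last first.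
  by apply/funext => x; rewrite mxE.
(* The integral is linear for two terms; the sum over columns follows by induction on the index
   list. *)
elim: (index_enum _) => [|l r IHr].
  rewrite big_nil -[RHS]cintegral0; congr cintegral.
  by apply/funext => x; rewrite big_nil.
rewrite big_cons -IHr -cintegralZD//.
  by congr cintegral; apply/funext => x; rewrite big_cons.
by apply: csqint_sum => h; exact: csqintZ.
Qed.

End SubInterval.

(** The gain of regularity on which the calculus rests: one integration turns a square integrable
    function into a continuous one. *)
Lemma volterra_continuous p : sqintmx p -> mxcontinuous (volterra p).
Proof.
move=> pL i j; have [pr pi] := pL i; split.
  have /= := parameterized_integral_continuous ler01 (sqint_integrable pr).
  by apply: eq_within_continuous => x; rewrite mxE (ord1 j).
have /= := parameterized_integral_continuous ler01 (sqint_integrable pi).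
by apply: eq_within_continuous => x; rewrite mxE (ord1 j).
Qed.

Lemma volterraD f g x : I01 x -> sqintmx f -> sqintmx g ->
  volterra (fun t => f t + g t) x = volterra f x + volterra g x.
Proof. by move=> xI; apply: mxintegralD => //; exact: sub_itv0x. Qed.

Lemma volterra_mulmx (A : 'M[R[i]]_k) f x : I01 x -> sqintmx f ->
  volterra (fun t => A *m f t) x = A *m volterra f x.
Proof. by move=> xI; apply: mxintegral_mulmx => //; exact: sub_itv0x. Qed.

Lemma cintegral_itvx1 (u : R -> R[i]) x : I01 x -> csqint u ->
  cintegral `[x, 1] u = cintegral `[0, 1] u - cintegral `[0, x] u.
Proof.
have H (h : R -> R) : I01 x -> sqint h -> \int[mu]_(t in `[x, 1]) h t =
    \int[mu]_(t in I01) h t - \int[mu]_(t in `[0, x]) h t.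
  move=> xI /sqint_integrable hI; move: (xI).
  rewrite /= in_itv/= => /andP[x0 x1].
  rewrite Rintegral_itvB// Rintegral_itv_obnd_cbnd//.
  by apply: integrableS hI => //; apply: subset_itvr; rewrite bnd_simp.
by move=> xI [ur ui]; rewrite /cintegral !H.
Qed.

(** Writing the integral over [x, 1] as V p(1) - V p(x) splits the operator into a Volterra part and
    a constant function. *)
Lemma intfun_volterra (A B : 'M[R[i]]_k) p x : I01 x -> sqintmx p ->
  intfun A B p x = (A - B) *m volterra p x + B *m volterra p 1.
Proof.
move=> xI pL; rewrite /intfun mulmxBl -addrA; congr (_ + _).
rewrite [RHS]addrC -mulmxBr; congr (_ *m _).
by apply/matrixP => i j; rewrite !mxE (ord1 j) cintegral_itvx1.
Qed.

End VectorIntegral.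

(** * Inverting the Volterra part *)

Section Resolvent.
Context {R : realType} {k : nat}.
Local Notation I01 := (`[0%R, 1%R]%classic : set R).
Implicit Types (M : 'M[R[i]]_k) (p : R -> 'cV[R[i]]_k).

Definition expflow M (x : R) : 'M[R[i]]_k := expmx (x%:C *: M).

Lemma gammamxE M : gammamx M = volterra (expflow M) 1.
Proof. by []. Qed.

Lemma expflow0 M : expflow M 0 = 1%:M.
Proof. exact: expmx0. Qed.

Lemma expflow_comm M x : M *m expflow M x = expflow M x *m M.
Proof. exact: expmx_comm. Qed.

Lemma expflowK M x (c : 'cV[R[i]]_k) : I01 x ->
  expflow M x *m (expflow (- M) x *m c) = c.
Proof. by move=> xI; rewrite mulmxA expmx_mulN// mul1mx. Qed.

Lemma mxprimitive_expflow M :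
  mxprimitive (fun x => M *m expflow M x) (expflow M).
Proof. exact: mxprimitive_expmx. Qed.

Lemma expflow_continuous M : mxcontinuous (expflow M).
Proof. exact: mxprimitive_continuous (mxprimitive_expflow M). Qed.

Lemma expflow_sqint M (c : 'cV[R[i]]_k) : sqintmx (fun x => expflow M x *m c).
Proof.
apply/mxcontinuous_sqint/mxcontinuousM; first exact: expflow_continuous.
exact: mxcontinuous_cst.
Qed.

(** M e^{tM} c is the derivative of e^{tM} c. The factor [M] stays on the left because [M] may be
    singular. *)
Lemma volterra_expflow M (c : 'cV[R[i]]_k) x : I01 x ->
  M *m volterra (fun t => expflow M t *m c) x = expflow M x *m c - c.
Proof.
move=> xI; rewrite -volterra_mulmx//; last exact: expflow_sqint.
have := mxprimitiveM (mxprimitive_expflow M) (mxprimitive_cst c).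
move=> /volterra_primitive => /(_ _ xI); rewrite expflow0 mul1mx => <-.
by apply: eq_volterra => // t _; rewrite mulmx0 addr0 mulmxA.
Qed.

Lemma gammamx_mulmx M (c : 'cV[R[i]]_k) :
  gammamx M *m c = volterra (fun t => expflow M t *m c) 1.
Proof.
have I1 : I01 1 by rewrite /= in_itv/= ler01 lexx.
have := mxprimitiveM (mxprimitive_volterra (expflow_continuous M))
  (mxprimitive_cst c).
move=> /volterra_primitive => /(_ _ I1).
rewrite gammamxE volterra0 mul0mx subr0 => <-.
by apply: eq_volterra => // t _; rewrite mulmx0 addr0.
Qed.

(* If h = M V h + d, then e^{-xM} h(x) has zero derivative. *)
Lemma volterra_fixpoint M (h : R -> 'cV[R[i]]_k) (d : 'cV[R[i]]_k) :
  sqintmx h ->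
  (forall x, I01 x -> h x = M *m volterra h x + d) ->
  forall x, I01 x -> h x = expflow M x *m d.
Proof.
(* [h] is only known to be square integrable; [u] agrees with it on [0, 1] and is continuous there,
   so it can be integrated back. *)
move=> hL hE x xI; pose u y := M *m volterra h y + d.
have uc : mxcontinuous u.
  apply: mxcontinuousD; last exact: mxcontinuous_cst.
  apply: mxcontinuousM; [exact: mxcontinuous_cst|exact: volterra_continuous].
have huE y : I01 y -> volterra h y = volterra u y.
  by move=> yI; apply: eq_volterra.
(* The function e^{-yM} u(y) has derivative -M e^{-yM} u(y) + e^{-yM} M u(y), which vanishes by
   commutation. *)
have := mxprimitiveM (mxprimitive_expflow (- M)) (mxprimitiveD
  (mxprimitiveM (mxprimitive_cst M) (mxprimitive_volterra uc))
  (mxprimitive_cst d)).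
move=> /volterra_primitive => /(_ _ xI).
rewrite (eq_volterra (g := fun=> 0)) => [|//|y yI].
  rewrite (volterra_primitive (mxprimitive_cst 0))// subrr.
  rewrite volterra0 mulmx0 add0r expflow0 mul1mx -huE// -hE//.
  by move=> /esym/subr0_eq <-; rewrite expflowK.
rewrite mul0mx add0r addr0 expflow_comm -mulmxA mulNmx mulmxN.
by rewrite -(huE y yI) addNr.
Qed.

(** Variation of constants gives p(x) + M times the integral of e^{(x-t)M} p(t) over [0, x].
    Integration by parts then replaces [p] under the exponential by its continuous primitive, which
    yields this form. *)
Definition resolvent M p : R -> 'cV[R[i]]_k := fun x =>
  p x + M *m (volterra p x + M *m (expflow M x *m
    volterra (fun t => expflow (- M) t *m volterra p t) x)).

Lemma resolvent_sqint M p : sqintmx p -> sqintmx (resolvent M p).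
Proof.
move=> pL; apply: sqintmxD => //; apply/mxcontinuous_sqint.
apply: mxcontinuousM; first exact: mxcontinuous_cst.
apply: mxcontinuousD; first exact: volterra_continuous.
apply: mxcontinuousM; first exact: mxcontinuous_cst.
apply: mxcontinuousM; first exact: expflow_continuous.
apply/volterra_continuous/mxcontinuous_sqint.
apply: mxcontinuousM; first exact: expflow_continuous.
exact: volterra_continuous.
Qed.

(** Let w be the right-hand side, so that [resolvent M p] = p + M w, and let E = [expflow M]. By the
    product rule the derivative of E Q is M E Q + V p = w. Hence V w = E Q, and V(p + M w) = V p + M
    E Q = w. *)
Lemma volterra_resolvent M p x : sqintmx p -> I01 x ->
  volterra (resolvent M p) x = volterra p x + M *m (expflow M x *m
    volterra (fun t => expflow (- M) t *m volterra p t) x).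
Proof.
move=> pL xI.
have Vc := volterra_continuous pL.
have gc : mxcontinuous (fun t => expflow (- M) t *m volterra p t).
  by apply: mxcontinuousM => //; exact: expflow_continuous.
set Q := volterra (fun t => expflow (- M) t *m volterra p t).
have Qc : mxcontinuous Q by exact/volterra_continuous/mxcontinuous_sqint.
have EQc : mxcontinuous (fun t => expflow M t *m Q t).
  by apply: mxcontinuousM => //; exact: expflow_continuous.
have MEQc : mxcontinuous (fun t => M *m (expflow M t *m Q t)).
  by apply: mxcontinuousM => //; exact: mxcontinuous_cst.
have VMEQc := mxcontinuousD Vc MEQc.
have VMEQL := mxcontinuous_sqint VMEQc.
rewrite (volterraD xI pL (sqintmx_mulmx M VMEQL)) (volterra_mulmx M xI VMEQL).
congr (_ + M *m _).
(* Since Q(0) = 0, the boundary term E(0) Q(0) can be subtracted, which gives the right side the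
   shape F x - F 0. *)
rewrite -[RHS]subr0 -[X in _ = _ - X](mulmx0 _ (expflow M 0)).
rewrite -[X in _ = _ - _ *m X](volterra0
  (fun t => expflow (- M) t *m volterra p t)).
rewrite -(volterra_primitive
  (mxprimitiveM (mxprimitive_expflow M) (mxprimitive_volterra gc)) xI).
apply: (eq_volterra xI) => t tI.
rewrite [LHS]addrC -[in RHS]mulmxA; congr (_ + _).
exact/esym/expflowK.
Qed.

Lemma resolventK M p x : sqintmx p -> I01 x ->
  resolvent M p x - M *m volterra (resolvent M p) x = p x.
Proof. by move=> pL xI; rewrite volterra_resolvent// /resolvent addrK. Qed.

End Resolvent.

(** * L^2 estimates *)

Section L2Bounds.
Context {R : realType}.
Local Notation mu := (@lebesgue_measure R).
Local Notation I01 := (`[0%R, 1%R]%classic : set R).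
Implicit Types u : R -> R.

Lemma Rintegral_cst01 (C : R) : \int[mu]_(t in I01) C = C.
Proof.
by rewrite Rintegral_cst//= lebesgue_measure_itv/= lte01 oppr0 adde0 mulr1.
Qed.

Lemma integrable_cst01 (C : R) : mu.-integrable I01 (EFin \o cst C).
Proof.
apply: sqint_integrable; apply: (@sqint_bounded _ _ `|C|) => //.
Qed.

Lemma normr_Rintegral_itv u x : sqint u -> I01 x ->
  `|\int[mu]_(t in `[0, x]) u t| <= \int[mu]_(t in I01) `|u t|.
Proof.
move=> /sqint_integrable uI; rewrite /= in_itv/= => /andP[x0 x1].
have sub : `[0, x] `<=` I01 by apply: subset_itvl; rewrite bnd_simp.
apply: (le_trans (le_normr_Rintegral _ _)) => //; first exact: integrableS uI.
have nuI : mu.-integrable I01 (fun t => `|u t|%:E).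
  exact: (@integrable_norm _ _ _ mu _ u).
rewrite /Rintegral fine_le//.
- by apply: integrable_fin_num => //; exact: integrableS nuI.
- exact: integrable_fin_num.
- apply: ge0_subset_integral => //.
  by move/integrableP: nuI => [].
Qed.

Lemma normr_Rintegral_itv_le u x C : sqint u -> I01 x ->
  (forall t, I01 t -> `|u t| <= C) -> `|\int[mu]_(t in `[0, x]) u t| <= C.
Proof.
move=> uL xI uC; apply: le_trans (normr_Rintegral_itv uL xI) _.
rewrite -[leRHS]Rintegral_cst01; apply: le_Rintegral => //.
- exact/(@integrable_norm _ _ _ mu _ u)/sqint_integrable.
- exact: integrable_cst01.
Qed.

Lemma sqint_sqr_integrable u :
  sqint u -> mu.-integrable I01 (EFin \o (fun x => u x ^+ 2)).
Proof.
move=> uL; have /Lfun1_integrable := Lfun2_mul_Lfun1 uL uL.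
rewrite (_ : _ \* _ = (fun x => u x ^+ 2) \_ I01); last first.
  by apply/funext => x; rewrite /= !patchE; case: ifP => _; rewrite ?mulr0.
by rewrite -restrict_EFin => uI; exact/integrable_mkcond.
Qed.

(** Cauchy-Schwarz against the constant 1 on an interval of length 1. *)
Lemma sqr_Rintegral_abs_le u : sqint u ->
  (\int[mu]_(t in I01) `|u t|) ^+ 2 <= \int[mu]_(t in I01) u t ^+ 2.
Proof.
move=> uL; set m := \int[mu]_(t in I01) `|u t|.
have uI := @integrable_norm _ _ _ mu _ u (sqint_integrable uL).
have u2I := sqint_sqr_integrable uL.
have cI := integrable_cst01 (m ^+ 2).
(* integrate [2 m |u| <= u^2 + m^2] *)
have : \int[mu]_(t in I01) (2 * m * `|u t|) <=
    \int[mu]_(t in I01) (u t ^+ 2 + m ^+ 2).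
  apply: le_Rintegral => //.
  - exact: (@integrableZl _ _ _ mu _ _ (2 * m) _ uI).
  - exact: (@integrableD _ _ _ mu _ _ _ _ u2I cI).
  - move=> t _; rewrite -(real_normK (num_real (u t))).
    by have := sqr_ge0 (`|u t| - m); nra.
rewrite RintegralZl// RintegralD// Rintegral_cst01 -/m.
nra.
Qed.

End L2Bounds.

(** * Norm estimates for vector-valued functions *)

Section VectorBounds.
Context {R : realType} {k : nat}.
Local Notation mu := (@lebesgue_measure R).
Local Notation I01 := (`[0%R, 1%R]%classic : set R).

Definition sqnorm (v : 'cV[R[i]]_k) : R :=
  \sum_(i < k) Normc.normc (v i ord0) ^+ 2.

Lemma sqr_normc_ReIm (z : R[i]) :
  Normc.normc z ^+ 2 = complex.Re z ^+ 2 + complex.Im z ^+ 2.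
Proof. by case: z => a b /=; rewrite sqr_sqrtr// addr_ge0 ?sqr_ge0. Qed.

Lemma mxabs_cV (v : 'cV[R[i]]_k) : mxabs v = \sum_i cabs (v i ord0).
Proof. by apply: eq_bigr => i _; rewrite big_ord1. Qed.

Lemma sqr_sum_le (b : 'I_k -> R) :
  (\sum_i b i) ^+ 2 <= k%:R * \sum_i b i ^+ 2.
Proof.
apply: (@le_trans _ _ (\sum_i \sum_j (b i ^+ 2 + b j ^+ 2) / 2)).
  rewrite expr2 mulr_suml; apply: ler_sum => i _.
  rewrite mulr_sumr; apply: ler_sum => j _.
  by have := sqr_ge0 (b i - b j); nra.
under eq_bigr do rewrite -mulr_suml big_split/= sumr_const card_ord.
rewrite -mulr_suml big_split/= sumr_const card_ord sumrMnl.
by rewrite -(mulr_natl (\sum_(i < k) b i ^+ 2)); lra.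
Qed.

(** The factor [k] comes from the sum over coordinates, the factor 2 from (|a| + |b|)^2 <= 2 (a^2 +
    b^2) for real and imaginary parts. *)
Lemma sqr_mxabs_le (v : 'cV[R[i]]_k) : mxabs v ^+ 2 <= (2 * k%:R) * sqnorm v.
Proof.
rewrite mxabs_cV (le_trans (sqr_sum_le _))// [2 * _]mulrC -mulrA.
rewrite ler_wpM2l// /sqnorm mulr_sumr; apply: ler_sum => i _.
rewrite sqr_normc_ReIm /cabs.
rewrite -(real_normK (num_real (complex.Re _))).
rewrite -(real_normK (num_real (complex.Im _))).
by have := sqr_ge0 (`|complex.Re (v i ord0)| - `|complex.Im (v i ord0)|); nra.
Qed.

Lemma sqnorm_le (v : 'cV[R[i]]_k) : sqnorm v <= mxabs v ^+ 2.
Proof.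
rewrite mxabs_cV [leRHS]expr2 mulr_suml; apply: ler_sum => i _.
rewrite mulr_sumr (bigD1 i)//= -[leLHS]addr0 lerD//; last first.
  by apply: sumr_ge0 => j _; rewrite mulr_ge0 ?cabs_ge0.
rewrite sqr_normc_ReIm /cabs.
rewrite -(real_normK (num_real (complex.Re _))).
rewrite -(real_normK (num_real (complex.Im _))).
have := normr_ge0 (complex.Re (v i ord0)).
have := normr_ge0 (complex.Im (v i ord0)).
by nra.
Qed.

Lemma sqnorm_integrable (f : R -> 'cV[R[i]]_k) :
  sqintmx f -> mu.-integrable I01 (EFin \o (fun x => sqnorm (f x))).
Proof.
move=> fL; rewrite (_ : _ \o _ = fun x => (\sum_(i < k)
    ((complex.Re (f x i ord0) ^+ 2)%:E + (complex.Im (f x i ord0) ^+ 2)%:E))%E).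
  apply: integrable_sum => // i _; have [fr fi] := fL i.
  exact: (integrableD _ (sqint_sqr_integrable fr) (sqint_sqr_integrable fi)).
apply/funext => x /=; rewrite -sumEFin; apply: eq_bigr => i _.
by rewrite sqr_normc_ReIm EFinD.
Qed.

(** Unfolds to the right-hand side of [L2norm_pi], so estimates on functions pass to classes. *)
Definition l2norm (f : R -> 'cV[R[i]]_k) : R :=
  Num.sqrt (\int[mu]_(x in I01) sqnorm (f x)).

Lemma sqnorm_integral_ge0 (f : R -> 'cV[R[i]]_k) :
  0 <= \int[mu]_(x in I01) sqnorm (f x).
Proof.
apply: Rintegral_ge0 => x _; apply: sumr_ge0 => i _; exact: sqr_ge0.
Qed.

(** V maps L^2 into L^oo: each of the [2 * k] real components of [f] has an integral bounded by
    [l2norm f], by Cauchy-Schwarz. *)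
Lemma volterra_l2norm (f : R -> 'cV[R[i]]_k) x : sqintmx f -> I01 x ->
  mxabs (volterra f x) <= (2 * k%:R) * l2norm f.
Proof.
move=> fL xI.
have H (u : R -> R) : sqint u ->
    (forall t, u t ^+ 2 <= sqnorm (f t)) ->
    `|\int[mu]_(t in `[0, x]) u t| <= l2norm f.
  move=> uL uf; apply: le_trans (normr_Rintegral_itv uL xI) _.
  rewrite -[leLHS]ger0_norm; last by apply: Rintegral_ge0.
  rewrite -sqrtr_sqr ler_wsqrtr// (le_trans (sqr_Rintegral_abs_le uL))//.
  apply: le_Rintegral => //; first exact: sqint_sqr_integrable.
  exact: sqnorm_integrable.
have sqnorm_entry i t : complex.Re (f t i ord0) ^+ 2 +
    complex.Im (f t i ord0) ^+ 2 <= sqnorm (f t).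
  rewrite -sqr_normc_ReIm /sqnorm (bigD1 i)//= lerDl.
  by apply: sumr_ge0 => j _; exact: sqr_ge0.
rewrite mxabs_cV [leRHS](_ : _ = \sum_(i < k) (l2norm f + l2norm f)).
  apply: ler_sum => i _; rewrite mxE; have [fr fi] := fL i.
  rewrite /cabs lerD//= H// => t; apply: le_trans (sqnorm_entry i t).
    by rewrite lerDl sqr_ge0.
  by rewrite lerDr sqr_ge0.
by rewrite sumr_const card_ord -mulr_natl; lra.
Qed.

Lemma volterra_bounded (f : R -> 'cV[R[i]]_k) x C : sqintmx f -> I01 x ->
  (forall t, I01 t -> mxabs (f t) <= C) ->
  mxabs (volterra f x) <= (2 * k%:R) * C.
Proof.
move=> fL xI fC.
rewrite mxabs_cV [leRHS](_ : _ = \sum_(i < k) (C + C)).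
  apply: ler_sum => i _; rewrite mxE; have [fr fi] := fL i.
  rewrite /cabs lerD//= normr_Rintegral_itv_le// => t /fC; apply: le_trans;
    apply: le_trans (cabs_le_mxabs _ i ord0).
    by rewrite lerDl.
  by rewrite lerDr.
by rewrite sumr_const card_ord -mulr_natl; lra.
Qed.

(** Shaped for an operator that is a multiple of the identity plus one with values in L^oo. With a =
    [mxabs (g x)] and N = [l2norm g], one has (C1 a + C2 N)^2 <= 2 C1^2 a^2 + 2 C2^2 N^2 and a^2 <=
    2 k [sqnorm (g x)]; integrating gives the constant. *)
Lemma l2norm_le (f g : R -> 'cV[R[i]]_k) C1 C2 : sqintmx f -> sqintmx g ->
  0 <= C1 -> 0 <= C2 ->
  (forall x, I01 x -> mxabs (f x) <= C1 * mxabs (g x) + C2 * l2norm g) ->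
  l2norm f <= Num.sqrt (4 * k%:R * C1 ^+ 2 + 2 * C2 ^+ 2) * l2norm g.
Proof.
move=> fL gL C10 C20 fg; set N := l2norm g.
have gI := sqnorm_integrable gL.
have gI' : mu.-integrable I01
    (EFin \o (fun x => 4 * k%:R * C1 ^+ 2 * sqnorm (g x))).
  exact: (@integrableZl _ _ _ mu _ _ (4 * k%:R * C1 ^+ 2) _ gI).
have cI := integrable_cst01 (2 * C2 ^+ 2 * N ^+ 2).
have N2 : \int[mu]_(x in I01) sqnorm (g x) = N ^+ 2.
  by rewrite sqr_sqrtr// sqnorm_integral_ge0.
rewrite -[X in _ <= _ * X]ger0_norm ?sqrtr_ge0// -sqrtr_sqr -sqrtrM; last first.
  by rewrite addr_ge0 ?mulr_ge0 ?sqr_ge0.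
rewrite ler_wsqrtr//.
apply: (@le_trans _ _ (\int[mu]_(x in I01)
    (4 * k%:R * C1 ^+ 2 * sqnorm (g x) + 2 * C2 ^+ 2 * N ^+ 2))).
  apply: le_Rintegral => //; first exact: sqnorm_integrable.
    exact: (@integrableD _ _ _ mu _ _ _ _ gI' cI).
  move=> x xI; apply: le_trans (sqnorm_le _) _.
  have := fg _ xI; have := sqr_mxabs_le (g x); rewrite -/N.
  have := mxabs_ge0 (f x); have := mxabs_ge0 (g x).
  move: (mxabs _) (mxabs _) (sqnorm _) => b a s a0 b0 as_ ba.
  apply: (@le_trans _ _ ((C1 * a + C2 * N) ^+ 2)).
    by rewrite ler_sqr ?nnegrE ?(le_trans b0).
  have := sqr_ge0 (C1 * a - C2 * N).
  have : 2 * C1 ^+ 2 * a ^+ 2 <= 2 * C1 ^+ 2 * (2 * k%:R * s).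
    by rewrite ler_wpM2l ?mulr_ge0 ?sqr_ge0.
  by nra.
rewrite RintegralD// RintegralZl// N2 Rintegral_cst01; lra.
Qed.

End VectorBounds.

(** * Spectrum *)

Section Spectrum.
Local Open Scope quotient_scope.
Context {R : realType} {k : nat} (A B : 'M[R[i]]_k) (lambda : R[i]).
Local Notation mu := (@lebesgue_measure R).
Local Notation I01 := (`[0%R, 1%R]%classic : set R).
Hypothesis lambda_neq0 : lambda != 0.
Local Notation M := (lambda^-1 *: (A - B)).
Local Notation P := (Pmx A B lambda).

Lemma mem01 : I01 1.
Proof. by rewrite /= in_itv/= ler01 lexx. Qed.

Definition sqint_of (f : R -> 'cV[R[i]]_k) (fL : sqintmx f) : sqintfun R k :=
  SqintFun (introT (sqintmxP f) fL).

Definition cst_sqint (c : 'cV[R[i]]_k) : sqintfun R k :=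
  sqint_of (mxcontinuous_sqint (mxcontinuous_cst c)).

Definition expflow_sqintfun (c : 'cV[R[i]]_k) : sqintfun R k :=
  sqint_of (expflow_sqint M c).

Lemma sqintfun_sqintmx (f : sqintfun R k) : sqintmx f.
Proof. exact/sqintmxP/sqintfunP. Qed.

Definition resolvent_sqintfun (f : sqintfun R k) : sqintfun R k :=
  sqint_of (resolvent_sqint M (sqintfun_sqintmx f)).

Lemma pi_L2_eq (f g : sqintfun R k) :
  (forall x, I01 x -> f x = g x) -> \pi_(L2 R k) f = \pi_(L2 R k) g.
Proof. by move=> fg; apply/L2_eqP; apply: aeW. Qed.

Lemma pi_L2_0 : \pi_(L2 R k) 0 = 0.
Proof. by rewrite piE. Qed.

Lemma pi_L2Z a (f : sqintfun R k) : \pi_(L2 R k) (a *: f) = a *: \pi_(L2 R k) f.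
Proof. by rewrite -[RHS]/(L2_scale a _) pi_L2_scale. Qed.

(** Since A - B = lambda M, a computation in the quotient reduces to a pointwise identity on
    [0, 1]. *)
Lemma intop_sub_pi F H (FL : sqintmx F) (HL : sqintmx H) :
  (forall x, I01 x ->
    B *m volterra F 1 - lambda *: (F x - M *m volterra F x) = H x) ->
  intop A B (\pi_(L2 R k) (sqint_of FL)) - lambda *: \pi_(L2 R k) (sqint_of FL)
  = \pi_(L2 R k) (sqint_of HL).
Proof.
move=> FH; rewrite intop_pi -scaleNr -pi_L2Z -pi_L2D; apply: pi_L2_eq => x xI.
rewrite -[RHS]/(H x) -FH// -[LHS]/(intfun A B F x + - lambda *: F x).
rewrite intfun_volterra//.
rewrite scalerBr scalemxAl scalerA mulfV// scale1r scaleNr opprB.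
by rewrite [RHS]addrCA addrA.
Qed.

(** (1 - M V) sends e^{xM} c to the constant c, and the remaining boundary term is B gamma(M) c. *)
Lemma intop_sub_expflow c :
  intop A B (\pi_(L2 R k) (expflow_sqintfun c)) -
  lambda *: \pi_(L2 R k) (expflow_sqintfun c) =
  \pi_(L2 R k) (cst_sqint (P *m c)).
Proof.
apply: intop_sub_pi => x xI.
rewrite (volterra_expflow M c xI) subKr -gammamx_mulmx mulmxDl mulmxA.
by rewrite mulNmx mul_scalar_mx addrC.
Qed.

(** Here (1 - M V) gives back [f]; what remains is a constant function, which an exponential term
    can cancel when [P] is invertible. *)
Lemma intop_sub_resolvent (f : sqintfun R k) :
  intop A B (\pi_(L2 R k) (resolvent_sqintfun f)) -
    lambda *: \pi_(L2 R k) (resolvent_sqintfun f) =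
  \pi_(L2 R k) (cst_sqint (B *m volterra (resolvent M f) 1)) -
    lambda *: \pi_(L2 R k) f.
Proof.
have fL := sqintfun_sqintmx f.
pose c := B *m volterra (resolvent M f) 1.
have HL : sqintmx (fun x => c + (- lambda)%:M *m f x).
  apply: sqintmxD (sqintmx_mulmx _ fL).
  exact: sqintfun_sqintmx (cst_sqint c).
transitivity (\pi_(L2 R k) (sqint_of HL)).
  apply: intop_sub_pi => x xI.
  by rewrite (resolventK M fL xI) mul_scalar_mx scaleNr.
rewrite -scaleNr -pi_L2Z -pi_L2D; apply: pi_L2_eq => x xI.
rewrite -[LHS]/(c + (- lambda)%:M *m f x) mul_scalar_mx.
by [].
Qed.

(** For c != 0 the exceptional set would contain all of [0, 1], whose measure is 1. *)
Lemma ae_cst0 (c : 'cV[R[i]]_k) :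
  (cst c : R -> 'cV[R[i]]_k) = cst 0 %[ae mu in I01] -> c = 0.
Proof.
move=> c0; apply/eqP; apply/negPn/negP => /eqP cN0.
have : (mu.-negligible I01).
  by apply: negligibleS c0 => x xI /(_ xI).
move=> /negligibleP => /(_ (measurable_itv _)).
rewrite /= lebesgue_measure_itv/= lte01 oppr0 adde0 => -[] /eqP.
by rewrite oner_eq0.
Qed.

Lemma pi_cst_eq0 c : \pi_(L2 R k) (cst_sqint c) = 0 -> c = 0.
Proof. by rewrite -pi_L2_0 => /L2_eqP /ae_cst0. Qed.

Lemma eq_volterra_pi (f g : sqintfun R k) x :
  \pi_(L2 R k) f = \pi_(L2 R k) g -> I01 x -> volterra f x = volterra g x.
Proof.
move=> /L2_eqP fg xI; apply: eq_ae_mxintegral => //.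
exact: (@sub_itv0x R x xI).
Qed.

(** If e^{xM} c vanishes almost everywhere, its primitive vanishes on [0, 1], so e^{xM} c - c = 0
    there. The constant c then represents the zero class. *)
Lemma pi_expflow_eq0 c : \pi_(L2 R k) (expflow_sqintfun c) = 0 -> c = 0.
Proof.
move=> E0; apply: pi_cst_eq0; rewrite -E0; apply: pi_L2_eq => x xI.
have := volterra_expflow M c xI.
rewrite -[volterra _ x]/(volterra (expflow_sqintfun c) x).
rewrite (eq_volterra_pi (g := cst_sqint 0) _ xI) => [|]; last first.
  by rewrite E0 -pi_L2_0; apply: pi_L2_eq.
have -> : volterra (cst_sqint 0) x = 0.
  by rewrite (volterra_primitive (mxprimitive_cst 0) xI) subrr.
by rewrite mulmx0 => /esym/subr0_eq /esym.
Qed.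

Lemma eigenP p : intop A B p = lambda *: p ->
  exists c, P *m c = 0 /\ p = \pi_(L2 R k) (expflow_sqintfun c).
Proof.
(* [h] is another representative of [p], given by an integral formula, so that the fixpoint equation
   holds at every point of [0, 1]. *)
move=> Tp; pose f := repr p; pose h := lambda^-1 *: intfun_sqintfun A B f.
have hp : \pi_(L2 R k) h = p.
  by rewrite pi_L2Z -intop_pi reprK Tp scalerA mulVf// scale1r.
have hf x : I01 x -> volterra f x = volterra h x.
  by apply: eq_volterra_pi; rewrite hp reprK.
pose d := lambda^-1 *: (B *m volterra f 1).
have hE x : I01 x -> h x = expflow M x *m d.
  apply: volterra_fixpoint; first exact: sqintfun_sqintmx.
  move=> y yI; rewrite -hf// -[LHS]/(lambda^-1 *: intfun A B f y).
  rewrite intfun_volterra//; last exact: sqintfun_sqintmx.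
  by rewrite scalerDr scalemxAl.
exists d; have pE : p = \pi_(L2 R k) (expflow_sqintfun d).
  by rewrite -hp; apply: pi_L2_eq => x /hE.
split=> //; apply: pi_cst_eq0.
(* The class of the constant P d is (T - lambda) p, which is 0. *)
by rewrite -intop_sub_expflow -pE Tp subrr.
Qed.

Definition solve (q : L2 R k) : L2 R k :=
  lambda^-1 *: (\pi_(L2 R k) (expflow_sqintfun
      (invmx P *m (B *m volterra (resolvent M (repr q)) 1))) -
    \pi_(L2 R k) (resolvent_sqintfun (repr q))).

Lemma intop_subZB a (u v : L2 R k) :
  intop A B (a *: (u - v)) - lambda *: (a *: (u - v)) =
  a *: ((intop A B u - lambda *: u) - (intop A B v - lambda *: v)).
Proof.
rewrite linearZ linearB/= scalerA mulrC -scalerA -scalerBr; congr (_ *: _).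
by rewrite (scalerBr lambda) !opprD !opprK addrACA.
Qed.

Lemma intop_sub_linear : linear (fun p : L2 R k => intop A B p - lambda *: p).
Proof.
move=> a u v; rewrite linearP scalerDr opprD addrACA scalerBr.
by rewrite !scalerA mulrC.
Qed.

Hypothesis Punit : P \in unitmx.

Lemma solveK : cancel solve (fun p => intop A B p - lambda *: p).
Proof.
move=> q; rewrite /solve intop_subZB intop_sub_expflow intop_sub_resolvent.
rewrite mulmxA mulmxV// mul1mx subKr scalerA mulVf// scale1r.
exact: reprK.
Qed.

(** By [eigenP] the kernel consists of classes of e^{xM} c with P c = 0, and an invertible [P]
    forces c = 0. *)
Lemma intop_sub_inj : injective (fun p : L2 R k => intop A B p - lambda *: p).
Proof.
move=> u v /eqP; rewrite -subr_eq0 => /eqP uv; apply/eqP; rewrite -subr_eq0.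
have /eigenP[c [Pc ->]] : intop A B (u - v) = lambda *: (u - v).
  apply: subr0_eq; rewrite -uv; have := intop_subZB 1 u v.
  by rewrite !scale1r.
have -> : c = 0 by rewrite -[c](mulKmx Punit) Pc mulmx0.
rewrite -pi_L2_0; apply/eqP/pi_L2_eq => x xI.
by rewrite -[LHS]/(expflow M x *m 0) mulmx0.
Qed.

(** [solve] goes through [repr], a choice that need not respect the operations; linearity is
    inherited from T - lambda, which is linear, injective, and has [solve] as right inverse. *)
Lemma solve_linear : linear solve.
Proof.
move=> a u v; apply: intop_sub_inj.
have /= -> := intop_sub_linear a (solve u) (solve v).
have /= -> := solveK (a *: u + v).
by have /= -> := solveK u; have /= -> := solveK v.
Qed.

End Spectrum.

(** * Boundedness of the inverse *)

Section Boundedness.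
Local Open Scope quotient_scope.

Lemma mxabsZ (R : realType) m n (a : R[i]) (A : 'M[R[i]]_(m, n)) :
  mxabs (a *: A) <= cabs a * mxabs A.
Proof.
rewrite /mxabs mulr_sumr; apply: ler_sum => i _.
rewrite mulr_sumr; apply: ler_sum => j _.
by rewrite mxE; exact: cabsM.
Qed.

Lemma volterra_resolvent_bounded (R : realType) k (M : 'M[R[i]]_k) :
  exists2 C, 0 <= C & forall p x, sqintmx p -> `[0, 1]%classic x ->
    mxabs (volterra (resolvent M p) x) <= C * l2norm p.
Proof.
have [e e0 eE] := mxcontinuous_bounded (expflow_continuous M).
have [e' e'0 eE'] := mxcontinuous_bounded (expflow_continuous (- M)).
(* Keeps [2 * k%:R] opaque as one factor while products are reassociated. *)
have [K KE] : exists K : R, K = 2 * k%:R by exists (2 * k%:R).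
have K0 : 0 <= K by rewrite KE mulr_ge0.
have M0 := mxabs_ge0 M.
(* The first [K] bounds V p. The product follows M e^{xM} V(e^{-tM} V p) from outside in, with one
   [K] for each integration. *)
exists (K + mxabs M * (e * (K * (e' * K)))).
  by rewrite addr_ge0// !mulr_ge0.
move=> p x pL xI; rewrite (volterra_resolvent M pL xI) mulrDl.
apply: le_trans (mxabsD _ _) _; apply: lerD.
  by rewrite KE volterra_l2norm.
apply: le_trans (mxabsM _ _) _; rewrite -!mulrA ler_wpM2l//.
apply: le_trans (mxabsM _ _) _; apply: ler_pM; rewrite ?mxabs_ge0 ?eE//.
rewrite KE; apply: volterra_bounded => //; rewrite -?KE.
  apply/mxcontinuous_sqint/mxcontinuousM; first exact: expflow_continuous.
  exact: volterra_continuous.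
move=> t tI; apply: le_trans (mxabsM _ _) _.
by apply: ler_pM; rewrite ?mxabs_ge0 ?eE'// KE volterra_l2norm.
Qed.

Lemma bounded_solve (R : realType) k (A B : 'M[R[i]]_k) (lambda : R[i]) :
  bounded_op (solve A B lambda).
Proof.
pose M := lambda^-1 *: (A - B); pose N := invmx (Pmx A B lambda) *m B.
have [C C0 VC] := volterra_resolvent_bounded M.
have [e e0 eE] := mxcontinuous_bounded (expflow_continuous M).
have M0 := mxabs_ge0 M; have N0 := mxabs_ge0 N.
pose l := cabs (lambda^-1); have l0 : 0 <= l := cabs_ge0 _.
(* The two terms bound e^{xM} d, with d = N V(R g)(1), and the part M V(R g) of R g; the other part
   of R g is [g] itself, whence the pointwise coefficient [l]. *)
pose C2 := l * (e * (mxabs N * C) + mxabs M * C).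
have C20 : 0 <= C2 by rewrite mulr_ge0// addr_ge0 ?mulr_ge0.
exists (Num.sqrt (4 * k%:R * l ^+ 2 + 2 * C2 ^+ 2)) => q.
pose g : sqintfun R k := repr q; have gL := sqintfun_sqintmx g.
pose d := invmx (Pmx A B lambda) *m (B *m volterra (resolvent M g) 1).
pose f : sqintfun R k := lambda^-1 *: (expflow_sqintfun A B lambda d +
  - 1 *: resolvent_sqintfun A B lambda g).
have -> : solve A B lambda q = \pi_(L2 R k) f.
  by rewrite pi_L2Z pi_L2D pi_L2Z scaleN1r.
rewrite L2norm_pi; apply: (l2norm_le (sqintfun_sqintmx f) gL l0 C20).
move=> x xI; have fE : f x = lambda^-1 *: (expflow M x *m d +
  -1 *: resolvent M g x) by [].
rewrite fE (le_trans (mxabsZ _ _))// -/l /C2 -mulrA -mulrDr ler_wpM2l//.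
have -> : resolvent M g x = g x + M *m volterra (resolvent M g) x.
  by rewrite -{1}(resolventK M gL xI) subrK.
have dC : mxabs d <= mxabs N * C * l2norm g.
  rewrite /d mulmxA (le_trans (mxabsM _ _))// -mulrA ler_wpM2l//.
  exact: VC _ _ gL (mem01).
have VCx := VC _ _ gL xI.
have c1 : cabs (-1 : R[i]) = 1 by rewrite /cabs /= normrN1 oppr0 normr0 addr0.
rewrite (le_trans (mxabsD _ _))// (le_trans (lerD (mxabsM _ _) (mxabsZ _ _)))//.
rewrite c1 mul1r addrC (le_trans (lerD (mxabsD _ _) (lexx _)))//.
rewrite -addrA lerD2l mulrDl [leRHS]addrC; apply: lerD.
  by rewrite (le_trans (mxabsM _ _))// -mulrA ler_wpM2l.
by rewrite -mulrA; apply: ler_pM; rewrite ?mxabs_ge0 ?eE.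
Qed.

End Boundedness.

(** * Determinant criterion and eigenfunctions *)

Lemma det0_mulmx (F : fieldType) k (A : 'M[F]_k) :
  \det A = 0 -> exists2 c : 'cV[F]_k, c != 0 & A *m c = 0.
Proof.
(* [det0P] yields a row vector killed from the left, so it is applied to the transpose. *)
rewrite -det_tr => /eqP/det0P[v v0 vA]; exists v^T; first by rewrite trmx_eq0.
by apply: trmx_inj; rewrite trmx_mul trmxK vA trmx0.
Qed.

Lemma eigenfunction_expflow (R : realType) k (A B : 'M[R[i]]_k)
    (lambda : R[i]) (c : 'cV[R[i]]_k) : lambda != 0 -> c != 0 ->
  Pmx A B lambda *m c = 0 ->
  eigenfunction (intop A B) lambda
    (\pi_(L2 R k)%qT (expflow_sqintfun A B lambda c)).
Proof.
move=> l0 c0 Pc; split.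
  by apply: contra_neq c0 => /pi_expflow_eq0.
apply: subr0_eq; rewrite intop_sub_expflow// Pc -pi_L2_0.
by apply: pi_L2_eq => x _; rewrite -[LHS]/(0 : 'cV[R[i]]_k).
Qed.

(** An invertible [P] makes [solve] a bounded inverse; a kernel vector of [P] gives an
    eigenfunction, which rules out any left inverse. *)
Lemma spectrum_det (R : realType) k (A B : 'M[R[i]]_k) (lambda : R[i]) :
  lambda != 0 -> spectrum (intop A B) lambda <-> \det (Pmx A B lambda) = 0.
Proof.
move=> l0; split=> [nT|/det0_mulmx[c c0 Pc] [S [_ TS _]]].
  apply/eqP/negPn/negP => detP; apply: nT.
  have Pu : Pmx A B lambda \in unitmx by rewrite unitmxE unitfE.
  pose S : {linear L2 R k -> L2 R k} := HB.pack (solve A B lambda)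
    (GRing.isLinear.Build _ _ _ _ (solve A B lambda) (solve_linear l0 Pu)).
  exists S; split; first exact: bounded_solve.
    (* A right inverse of an injective map is also a left inverse. *)
    move=> p; apply: (intop_sub_inj l0 Pu); exact: (solveK l0 Pu).
  exact: (solveK l0 Pu).
(* The eigenfunction goes to 0 under T - lambda, so a linear left inverse would return 0 in its
   place. *)
have [/eqP + Tp] := eigenfunction_expflow l0 c0 Pc; apply.
have /= := TS (\pi_(L2 R k)%qT (expflow_sqintfun A B lambda c)).
by rewrite Tp subrr linear0.
Qed.

Theorem theorem4p2 (R : realType) (k : nat) (A B : 'M[R[i]]_k) :
  [set lambda : R[i] | spectrum (intop A B) lambda /\ lambda != 0] =
  [set lambda : R[i] | \det (Pmx A B lambda) = 0 /\ lambda != 0]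
  /\
  forall lambda : R[i], lambda != 0 -> \det (Pmx A B lambda) = 0 ->
    (forall p : L2 R k, eigenfunction (intop A B) lambda p ->
       exists c : 'cV[R[i]]_k,
         [/\ c != 0, Pmx A B lambda *m c = 0 &
            (p : R -> 'cV[R[i]]_k) =
              (fun x : R => expmx (x%:C *: (lambda^-1 *: (A - B))) *m c)
              %[ae lebesgue_measure in `[0%R, 1%R]%classic]])
    /\
    (forall c : 'cV[R[i]]_k, c != 0 -> Pmx A B lambda *m c = 0 ->
       exists p : L2 R k, eigenfunction (intop A B) lambda p /\
         (p : R -> 'cV[R[i]]_k) =
           (fun x : R => expmx (x%:C *: (lambda^-1 *: (A - B))) *m c)
           %[ae lebesgue_measure in `[0%R, 1%R]%classic]).
Proof.
split.
  by apply/seteqP; split=> lambda /= [+ l0] => /(spectrum_det _ _ l0).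
move=> lambda l0 _; split=> [p [p0 /(eigenP l0)[c [Pc pE]]]|c c0 Pc].
  exists c; split=> //.
    apply: contra_neq p0 => c0; rewrite pE c0 -pi_L2_0.
    by apply: pi_L2_eq => x _; exact: mulmx0.
  (* As a function, [p] is its chosen representative, so equality of classes is the required
     equality almost everywhere. *)
  by apply/(L2_eqP (repr p) (expflow_sqintfun A B lambda c)); rewrite reprK.
exists (\pi_(L2 R k)%qT (expflow_sqintfun A B lambda c)); split.
  exact: eigenfunction_expflow.
by apply/(L2_eqP (repr _) (expflow_sqintfun A B lambda c)); rewrite reprK.
Qed.
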